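(* (Generalization bound for vector-valued support vector regression.) Let $\mathcal{X}$ be a Polish space, $\mathcal{Y}$ a (possibly infinite-dimensional) separable Hilbert space, $\mathcal{H}\subset\mathcal{Y}^{\mathcal{X}}$ a separable reproducing kernel Hilbert space with operator-valued reproducing kernel $K$ such that, for all $y_1,y_2\in\mathcal{Y}$, the map $(x_1,x_2)\mapsto\langle K(x_1,x_2)y_1,y_2\rangle_{\mathcal{Y}}$ is measurable, and let $\lambda>0$, $\epsilon\ge0$. Assume that there is $\kappa>0$ with $\|K(x,x)\|_{op}\le\kappa^2$ for all $x\in\mathcal{X}$. Let $(X,Y)$ be a random pair with values in $\mathcal{X}\times\mathcal{Y}$ such that $\|Y\|_{\mathcal{Y}}<C_y$ almost surely for some $C_y>0$, and let $Z=\{(X_1,Y_1),\dots,(X_m,Y_m)\}$ consist of $m\ge1$ i.i.d. copies of $(X,Y)$. Let $c(y,f,x)=\max(\|y-f(x)\|_{\mathcal{Y}}-\epsilon,0)$ and $$f_Z=\arg\min_{f\in\mathcal{H}}\frac1m\sum_{k=1}^m c(Y_k,f,X_k)+\lambda\|f\|_{\mathcal{H}}^2,$$ where this minimizer is assumed to exist and be unique for every training set. Then for every $0<\delta\le1$, with probability at least $1-\delta$ over $Z$, $$\mathbb{E}\big(c(Y,f_Z,X)\big)\le R_{emp}(f_Z,Z)+\frac1m\,\frac{\kappa^2}{\lambda}+\sqrt{\frac1m}\left(\frac{2\kappa^2}{\lambda}+C_y\left(1+\frac{\kappa}{\sqrt\lambda}\right)\right)\sqrt{\frac{\ln(1/\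delta)}{2}}.$$
   Context: $L(\mathcal{Y})$ is the space of continuous linear endomorphisms of $\mathcal{Y}$ and $\|\cdot\|_{op}$ is the operator norm. $K:\mathcal{X}\times\mathcal{X}\to L(\mathcal{Y})$ is the (Hermitian, positive-definite) reproducing operator-valued kernel of $\mathcal{H}$ means: for all $x\in\mathcal{X}$, $y\in\mathcal{Y}$ the function $K(\cdot,x)y:x'\mapsto K(x',x)y$ belongs to $\mathcal{H}$; $\langle f(x),y\rangle_{\mathcal{Y}}=\langle f,K(\cdot,x)y\rangle_{\mathcal{H}}$ for all $f\in\mathcal{H}$, $x\in\mathcal{X}$, $y\in\mathcal{Y}$; $K(x_1,x_2)=K(x_2,x_1)^*$; and $\sum_{k,\ell=1}^n\langle K(x_k,x_\ell)y_\ell,y_k\rangle_{\mathcal{Y}}\ge0$ for all $n\ge1$, $x_1,\dots,x_n\in\mathcal{X}$, $y_1,\dots,y_n\in\mathcal{Y}$. The empirical risk is $R_{emp}(f,Z)=\frac1m\sum_{k=1}^m c(Y_k,f,X_k)$. In $\mathbb{E}(c(Y,f_Z,X))$ the pair $(X,Y)$ is independent of $Z$ and the expectation is taken over $(X,Y)$ only, with $Z$ fixed; the probability is over the draw of $Z$. *)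

(* Defs.v *)
From HB Require Import structures.
From mathcomp Require Import all_boot all_order all_algebra.
From mathcomp Require Import sesquilinear.
From mathcomp Require Import all_classical all_reals all_analysis.

Set Implicit Arguments.
Unset Strict Implicit.
Unset Printing Implicit Defensive.

Import Order.TTheory GRing.Theory Num.Theory.
Import numFieldNormedType.Exports.

Local Open Scope classical_set_scope.
Local Open Scope ring_scope.

(* Real Hilbert spaces. A complex Hilbert space is covered through its
   underlying real one, with inner product Re <_, _> and the same norm. *)
HB.mixin Record NormedModule_isHilbert (R : realType) V
    & NormedModule R V := {
  inner : {dot V for (@idfun R)} ;
  inner_normE : forall v : V, `|v| ^+ 2 = inner v v
}.

#[short(type="hilbertType")]
HB.structure Definition Hilbert (R : realType) :=
  {V of CompleteNormedModule R V & NormedModule_isHilbert R V}.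

Definition separable (T : topologicalType) :=
  exists2 D : set T, countable D & dense D.

Definition complete_metric_for (R : realType) (T : topologicalType)
    (d : T -> T -> R) :=
  [/\ forall x y, d x y = 0 <-> x = y,
      forall x y, d x y = d y x,
      forall x y z, d x z <= d x y + d y z,
      forall x (A : set T),
        nbhs x A <-> exists2 e : R, 0 < e & [set y | d x y < e] `<=` A &
      forall u : nat -> T,
        (forall e : R, 0 < e -> exists N, forall i j,
           (N <= i)%N -> (N <= j)%N -> d (u i) (u j) < e) ->
        exists l : T, u @ \oo --> l].

Definition polish (R : realType) (T : topologicalType) :=
  separable T /\ exists d : T -> T -> R, complete_metric_for d.

Definition borel (T : ptopologicalType) := g_sigma_algebraType (@open T).
HB.instance Definition _ (T : ptopologicalType) :=
  Measurable.copy (borel T) (g_sigma_algebraType (@open T)).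

(* The supremum is finite as soon as [A] is linear and continuous. *)
Definition opnorm (R : realType) (V : normedModType R) (A : V -> V) : R :=
  sup [set `|A v| | v in [set v : V | `|v| <= 1]].

(* The inclusion of [H] in [Y ^ X] is given by the linear injection [ev],
   [ev f x] being the value f(x). *)
Record is_rkhs (R : realType) (X : Type) (Y H : hilbertType R)
    (ev : {linear H -> (X -> Y)}) (K : X -> X -> {linear Y -> Y}) : Prop := {
  rkhs_ev_inj : injective ev ;
  rkhs_continuous : forall x1 x2, continuous (K x1 x2) ;
  rkhs_reproducing : forall x y, exists2 k : H,
    ev k = (fun x' => K x' x y) &
    forall f : H, inner (ev f x) y = inner f k ;
  rkhs_hermitian : forall x1 x2 y1 y2,
    inner (K x1 x2 y1) y2 = inner y1 (K x2 x1 y2) ;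
  rkhs_positive : forall n (x : 'I_n -> X) (y : 'I_n -> Y),
    0 <= \sum_(k < n) \sum_(l < n) (inner (K (x k) (x l) (y l)) (y k) : R)
}.

Definition mutually_independent d d' (T : measurableType d)
    (T' : measurableType d') (R : realType) (P : probability T R)
    (I : finType) (W : I -> {RV P >-> T'}) :=
  forall (J : {set I}) (B : I -> set T'), (forall i, measurable (B i)) ->
    P (\bigcap_(i in [set` J]) (W i @^-1` B i)) =
    (\prod_(i in J) P (W i @^-1` B i))%E.

Definition same_distribution d d' (T : measurableType d)
    (T' : measurableType d') (R : realType) (P : probability T R)
    (U V : {RV P >-> T'}) :=
  forall B : set T', measurable B -> distribution P U B = distribution P V B.

Section svr.
Context {R : realType} {X : Type} {Y H : hilbertType R}.
Variables (ev : {linear H -> (X -> Y)}) (eps lambda : R).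

Definition svr_loss (y : Y) (f : H) (x : X) : R :=
  Num.max (`|y - ev f x| - eps) 0.

Definition empirical_risk m (f : H) (z : 'I_m -> X * Y) : R :=
  m%:R^-1 * \sum_(k < m) svr_loss (z k).2 f (z k).1.

Definition svr_objective m (z : 'I_m -> X * Y) (f : H) : R :=
  empirical_risk f z + lambda * `|f| ^+ 2.

(* [fZ] maps each training set to the unique minimizer of its objective. *)
Definition svr_learner m (fZ : ('I_m -> X * Y) -> H) :=
  forall z, unique (fun f => forall g, svr_objective z f <= svr_objective z g)
    (fZ z).

End svr.

(* Main.v *)
(** Write [l_p(f) = c(p, f) - c(p, 0)] and [b = kappa^2 / lambda]. The gap
between risk and empirical risk splits into the gap at [f = 0], an average of
independent variables of range [Cy] to which Hoeffding's inequality applies, and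
the gap [D] of the losses [l_p] at [f_Z]. Uniform stability changes [D] by at
most [3 b / m] when one sample point is replaced, so bounded differences would
give the constant [3 b] next to [Cy]; the bound [Cy (1 + kappa / sqrt lambda)]
on the loss, which would absorb the excess, fails for [Cy < 1]. The constant [2
b] is obtained by estimating the mean of [D] under the law tilted by [exp (s
D)]: exchanging a sample point with an independent copy preserves the law and
changes the sign of the loss difference up to [2 b / m], and the first-order
condition for [f_Z] forces the positive parts of these differences to be small
on average unless [D] itself is close to its maximum [b]. Integrating in [s]
bounds the moment generating function of [D], and convexity of [exp] combines
the two parts. *)

Require Import Defs.
From HB Require Import structures.
From mathcomp Require Import all_boot all_order all_algebra.
From mathcomp Require Import sesquilinear.
From mathcomp Require Import all_classical all_reals all_analysis.
From mathcomp Require Import measurable_realfun.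
From mathcomp Require Import ring lra.

Set Implicit Arguments.
Unset Strict Implicit.
Unset Printing Implicit Defensive.

Import Order.TTheory GRing.Theory Num.Theory.
Import numFieldNormedType.Exports.

Local Open Scope classical_set_scope.
Local Open Scope ring_scope.

(** * Real inequalities *)

(** With [D] divided by [b] and [v = 1/m], the target is a tilted mean of at most [v + v s].
    Integrated in [s] it gives [v s + v s^2 / 2]: the linear term becomes the summand
    [kappa^2 / (lambda m)] of the bound, the quadratic one the constant [2 b]. Symmetrization alone
    yields a slope near 3 in [v s], since [D] moves by up to [3 v] under an exchange and the loss
    differences may reach 1. The slope comes down to 1 because the positive parts of these
    differences average to at most [1/9 + 8/9 D]: where the tilted mean of [D] is small, 3 is
    multiplied by little more than 1/9, and where it is large, the factor [1 - exp (- 3 s v)] is far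
    below [3 s v]. One polynomial inequality covers both regimes. A second obstacle is that the
    learner is an arbitrary map into [H]. Its measurability has to be extracted from strong
    convexity before these integrals make sense, and only real functions of it are ever measured:
    distances to fixed elements, then Lipschitz functionals. *)

Lemma exp_increment_le (R : realType) (x y : R) :
  expR y - expR x <= (y - x) * expR y.
Proof.
have := expR_ge1Dx (x - y).
rewrite -(ler_pM2r (expR_gt0 y)) -expRD subrK; lra.
Qed.

(** The trapezoidal rule overestimates the integral of a convex function, here [expR] over
    [[0, x]]. *)
Lemma exp_chord_le (R : realType) (x : R) : 0 <= x ->
  expR x - 1 <= x / 2 * (expR x + 1).
Proof.
move=> x0; pose g (y : R) : R := (y - 2) * expR y + y.
have dg (y : R) : is_derive y 1 g ((y - 1) * expR y + 1).
  rewrite /g; apply: is_derive_eq.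
  by rewrite /GRing.scale /=; lra.
have : g 0 <= g x.
  apply: (@ger0_derive1_le_cc _ g 0 x) => //.
  - move=> y _; rewrite derive1E (@derive_val _ _ _ _ _ _ _ (dg y)).
    have := exp_increment_le y 0; rewrite expR0; have := exp_increment_le 0 y.
    rewrite expR0; nra.
  - apply: continuous_subspaceT => y.
    by apply/differentiable_continuous/derivable1_diffP; case: (dg y).
  - by rewrite in_itv /= lexx.
  - by rewrite in_itv /= lexx andbT.
by rewrite /g expR0; lra.
Qed.

(** Integrates [phi' <= (a + b u) phi] without derivatives: an implicit Euler scheme with [n + 1]
    equal steps loses a factor [exp (s^2 c / (n + 1))] in total, which tends to 1. *)
Lemma discrete_gronwall (R : realType) (phi : R -> R) (a b s : R) :
  0 <= a -> 0 <= b -> 0 <= s -> (forall t, 0 <= phi t) ->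
  (forall t u, 0 <= t -> t <= u -> u <= s ->
    phi u - phi t <= (u - t) * (a + b * u) * phi u) ->
  phi s <= phi 0 * expR (a * s + b * s ^+ 2 / 2).
Proof.
move=> a0 b0 s0 phi0 H.
(* [B] bounds the rate on [[0, s]]. In [c], the part [2 B^2] pays for
   [1 / (1 - x) <= exp (x + 2 x^2)] on [[0, 1/2]], and [b / 2] for evaluating the rate at the right
   end of each step. *)
set B := a + b * s; set c := 2 * B ^+ 2 + b / 2.
have B0 : 0 <= B by rewrite /B; nra.
have c0 : 0 <= c by rewrite /c; nra.
have step n : s * B * 2 <= n.+1%:R -> phi s <=
    phi 0 * expR (a * s + b * s ^+ 2 / 2 + s ^+ 2 * c / n.+1%:R).
  move=> hn; set h := s / n.+1%:R.
  have N0 : (0 : R) < n.+1%:R by rewrite ltr0n.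
  have h0 : 0 <= h by rewrite divr_ge0.
  have hB : h * B <= 1 / 2.
    by rewrite /h mulrAC ler_pdivrMr //; lra.
  have ind k : (k <= n.+1)%N -> phi (k%:R * h) <=
      phi 0 * expR (a * (k%:R * h) + b * (k%:R * h) ^+ 2 / 2 + k%:R * h ^+ 2 * c).
    elim: k => [|k IH] kn.
      by rewrite !mul0r expr0n /= !mulr0 mul0r !addr0 expR0 mulr1.
    have k0 : (0 : R) <= k%:R by rewrite ler0n.
    have khs : k.+1%:R * h <= s.
      rewrite /h mulrCA ler_piMr // ler_pdivrMr // mul1r ler_nat //.
    have := H (k%:R * h) (k.+1%:R * h) (mulr_ge0 k0 h0).
    rewrite -natr1 in khs *; move=> /(_ _ khs).
    set x := h * (a + b * ((k%:R + 1) * h)).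
    have -> : ((k%:R + 1) * h - k%:R * h) * (a + b * ((k%:R + 1) * h)) = x.
      by rewrite /x; ring.
    have x0 : 0 <= x.
      by rewrite /x; apply: mulr_ge0 => //; apply: addr_ge0 => //; apply: mulr_ge0 => //; nra.
    have xB : x <= h * B.
      by rewrite /x /B ler_wpM2l // lerD2l ler_wpM2l.
    move=> /(_ ltac:(nra)) Hk.
    have {}Hk : phi ((k%:R + 1) * h) * (1 - x) <= phi (k%:R * h) by lra.
    have e1 : 1 <= (1 - x) * expR (x + 2 * x ^+ 2).
      apply: (@le_trans _ _ ((1 - x) * (1 + (x + 2 * x ^+ 2)))); first by nra.
      by rewrite ler_wpM2l ?expR_ge1Dx //; lra.
    have e2 : phi ((k%:R + 1) * h) <= phi (k%:R * h) * expR (x + 2 * x ^+ 2).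
      apply: (@le_trans _ _ (phi ((k%:R + 1) * h) * ((1 - x) * expR (x + 2 * x ^+ 2)))).
        by rewrite ler_peMr.
      by rewrite mulrA ler_wpM2r ?expR_ge0.
    apply: (le_trans e2).
    apply: (le_trans (ler_wpM2r (expR_ge0 _) (IH (ltnW kn)))).
    rewrite -[leLHS]mulrA -expRD ler_wpM2l // ler_expR.
    have x2 : x ^+ 2 <= h ^+ 2 * B ^+ 2 by rewrite -exprMn ler_pXn2r ?nnegrE //; nra.
    rewrite /c {1}/x.
    rewrite -subr_ge0.
    have -> : a * ((k%:R + 1) * h) + b * ((k%:R + 1) * h) ^+ 2 / 2 +
      (k%:R + 1) * h ^+ 2 * (2 * B ^+ 2 + b / 2) -
      (a * (k%:R * h) + b * (k%:R * h) ^+ 2 / 2 +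
      k%:R * h ^+ 2 * (2 * B ^+ 2 + b / 2) +
      (h * (a + b * ((k%:R + 1) * h)) + 2 * x ^+ 2)) =
      2 * (h ^+ 2 * B ^+ 2 - x ^+ 2) by field.
    lra.
  have hs : n.+1%:R * h = s by rewrite /h mulrC divfK // pnatr_eq0.
  have := ind n.+1 (leqnn _); rewrite hs.
  have -> : n.+1%:R * h ^+ 2 * c = s ^+ 2 * c / n.+1%:R.
    by rewrite /h; field; rewrite ?pnatr_eq0 // addrC natr1 pnatr_eq0.
  by [].
set G := a * s + b * s ^+ 2 / 2 in step *.
apply/ler_addgt0Pr => e e0.
have P0 : 0 <= phi s by [].
(* The first summand keeps every Euler step below 1/2; the second makes the error exponent [z]
   satisfy [z (phi s + 1) <= e], so that removing the factor [exp z] costs at most [e]. *)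
pose M := s * B * 2 + s ^+ 2 * c * (phi s + 1) / e.
have M0 : 0 <= M.
  rewrite /M; apply: addr_ge0; first by rewrite !mulr_ge0.
  apply: divr_ge0; last exact: ltW.
  by rewrite mulr_ge0 ?addr_ge0 // mulr_ge0 ?sqr_ge0.
pose n := Num.truncn M.
have Mn : M < n.+1%:R by exact: truncnS_gt.
have N0 : (0 : R) < n.+1%:R by rewrite ltr0n.
set z := s ^+ 2 * c / n.+1%:R.
have z0 : 0 <= z by rewrite divr_ge0 ?mulr_ge0 ?sqr_ge0.
have zP : z * (phi s + 1) <= e.
  rewrite /z mulrAC ler_pdivrMr // [e * _]mulrC -ler_pdivrMr //.
  by apply: le_trans (ltW Mn); rewrite /M lerDr !mulr_ge0.
have {step} := step n (le_trans _ (ltW Mn)).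
move=> /(_ _)/wrap[].
  by rewrite /M lerDl; apply: divr_ge0; [rewrite mulr_ge0 ?addr_ge0 // mulr_ge0 ?sqr_ge0|exact: ltW].
rewrite expRD mulrA -/z => Hz.
have Ez : expR z * (1 - z) <= 1.
  have := expR_ge1Dx (- z); rewrite -(ler_pM2l (expR_gt0 z)) -expRD subrr expR0; lra.
have Q0 : 0 <= phi 0 * expR G by rewrite mulr_ge0 ?expR_ge0.
have [z1|z1] := lerP 1 z; first by nra.
have : phi s * (1 - z) <= phi 0 * expR G.
  apply: (le_trans (ler_wpM2r _ Hz)); first by lra.
  by rewrite -[leLHS]mulrA; apply: ler_piMr.
nra.
Qed.

(* Hoeffding's lemma for a two-point distribution; exp_chord_le provides the
   1/4 in the logarithmic derivative. *)
Lemma two_point_mgf_le (R : realType) (p h : R) : 0 <= p <= 1 -> 0 <= h ->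
  (1 - p) * expR (p * h) + p * expR (- ((1 - p) * h)) <= expR (h ^+ 2 / 8).
Proof.
move=> /andP[p0 p1] h0.
pose phi (t : R) := (1 - p) * expR (p * t) + p * expR (- ((1 - p) * t)).
have := @discrete_gronwall R phi 0 4^-1 h (lexx _) _ h0.
rewrite /phi mul0r add0r !mulr0 oppr0 expR0 !mulr1 subrK mul1r.
have -> : 4^-1 * h ^+ 2 / 2 = h ^+ 2 / 8 by field.
apply; first by lra.
  by move=> t; rewrite addr_ge0 ?mulr_ge0 ?expR_ge0 //; lra.
move=> t u t0 tu uh; rewrite add0r.
have H1 := exp_increment_le (p * t) (p * u).
have H2 := exp_increment_le (- ((1 - p) * t)) (- ((1 - p) * u)).
set e := expR (- (u / 2)).
have e0 : 0 < e by exact: expR_gt0.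
have E2 : expR (- ((1 - p) * u)) = expR (p * u) * e ^+ 2.
  by rewrite expr2 -!expRD; congr expR; field.
have chord : 1 - e <= u / 4 * (1 + e).
  have := @exp_chord_le _ (u / 2) ltac:(lra).
  have eE : expR (u / 2) * e = 1 by rewrite /e -expRD subrr expR0.
  rewrite -(ler_pM2r e0); nra.
rewrite E2 in H2 *; set w := expR (p * u) in H1 H2 *.
have w0 : 0 < w by exact: expR_gt0.
(* Up to the common factor [w], the left side is the derivative and the last factor on the right the
   function itself. In [1 - e^2 = (1 + e)(1 - e)] the factor [1 - e] is bounded by [chord], and the
   rest by the square [(1 - p - p e)^2]. *)
have key : p * (1 - p) * (1 - e ^+ 2) <= u / 4 * (1 - p + p * e ^+ 2).
  have sq : p * (1 - p) * (1 + e) ^+ 2 <= 1 - p + p * e ^+ 2.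
    rewrite -subr_ge0.
    have -> : 1 - p + p * e ^+ 2 - p * (1 - p) * (1 + e) ^+ 2
      = (1 - p - p * e) ^+ 2 by ring.
    exact: sqr_ge0.
  have pp : 0 <= p * (1 - p) by rewrite mulr_ge0 // subr_ge0.
  apply: (@le_trans _ _ (u / 4 * (p * (1 - p) * (1 + e) ^+ 2))); last first.
    by rewrite ler_wpM2l //; lra.
  have -> : p * (1 - p) * (1 - e ^+ 2) = p * (1 - p) * (1 + e) * (1 - e) by ring.
  have -> : u / 4 * (p * (1 - p) * (1 + e) ^+ 2) =
    p * (1 - p) * (1 + e) * (u / 4 * (1 + e)) by ring.
  by rewrite ler_wpM2l // mulr_ge0 //; lra.
apply: (@le_trans _ _ ((u - t) * w * (p * (1 - p) * (1 - e ^+ 2)))).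
  have q0 : 0 <= 1 - p by lra.
  have := ler_wpM2l q0 H1; have := ler_wpM2l p0 H2; lra.
have -> : (u - t) * (4^-1 * u) * ((1 - p) * w + p * (w * e ^+ 2)) =
  (u - t) * w * (u / 4 * (1 - p + p * e ^+ 2)) by field.
by rewrite ler_wpM2l // mulr_ge0 ?(ltW w0) // subr_ge0.
Qed.

(* With [s = 5 w], the difference is expanded in the Bernstein basis. *)
Lemma saturation_poly_le (R : realFieldType) (s : R) : 0 <= s <= 1 ->
  (9 + 8 * s) ^+ 2 * (1 - (1 - 3 / 5 * s) ^+ 5) <= 288 * s.
Proof.
move=> /andP[s0 s1]; pose w := s / 5.
have -> : s = 5 * w by rewrite /w mulrC divfK // pnatr_eq0.
have -> : 3 / 5 * (5 * w) = 3 * w by field.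
have w0 : 0 <= w by rewrite divr_ge0.
have t0 : 0 <= 1 - 5 * w by rewrite /w mulrC divfK ?pnatr_eq0 // subr_ge0.
rewrite -subr_ge0; set t := 1 - 5 * w in t0 *.
have -> : 288 * (5 * w) - (9 + 8 * (5 * w)) ^+ 2 * (1 - (1 - 3 * w) ^+ 5) =
  w * (225%:R * w ^+ 0 * t ^+ 6 + 3240%:R * w ^+ 1 * t ^+ 5
    + 15 * (1037%:R * w ^+ 2 * t ^+ 4) + 15 * (3067%:R * w ^+ 3 * t ^+ 3)
    + 63 * (2180%:R * w ^+ 4 * t ^+ 2) + 27%:R * w ^+ 4 * t ^+ 2
    + 135 * (1982%:R * w ^+ 5 * t ^+ 1) + 15%:R * w ^+ 5 * t ^+ 1
    + 75 * (2041%:R * w ^+ 6 * t ^+ 0)) by rewrite /t; ring.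
repeat match goal with
| |- is_true (0 <= _ + _) => apply: addr_ge0
| |- is_true (0 <= _ * _) => apply: mulr_ge0
| |- is_true (0 <= _ ^+ _) => apply: exprn_ge0
| |- is_true (0 <= _%:R) => exact: ler0n
| |- _ => assumption
end.
Qed.

(** The exponential is bounded below by the fifth power of its tangent at [- (3/5) s]; with a fourth
    power the resulting polynomial inequality would fail near [s = 9/10]. The constant is
    [288 = 9 * 32], with 32 coming from the square completed in [tilted_mean_bound]. *)
Lemma saturation_le (R : realType) (s : R) : 0 <= s <= 1 ->
  (9 + 8 * s) ^+ 2 * (1 - expR (- (3 * s))) <= 288 * s.
Proof.
move=> s01; apply: le_trans (saturation_poly_le s01).
case/andP: s01 => s0 s1.
rewrite ler_wpM2l ?sqr_ge0 // lerD2l lerN2.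
have -> : - (3 * s) = 5%:R * (- (3 / 5 * s)) by field.
by rewrite expRM_natl ler_pXn2r ?nnegrE ?expR_ge0 ?expR_ge1Dx //; lra.
Qed.

(** [N] is the moment generating function at [s] and [M / N] the tilted mean. The hypothesis
    contains [M] on both sides with a smaller coefficient on the right, so it is enough to
    contradict it at the claimed value [M = (v + v s) N]. *)
Lemma tilted_mean_bound (R : realType) (v s M N : R) : 0 < v <= 1 -> 0 <= s ->
  0 < N -> M <= N ->
  M <= v * N + (1 - v) * (1 - expR (- (3 * (s * v)))) * (N / 9 + 8 / 9 * M) ->
  M <= (v + v * s) * N.
Proof.
move=> /andP[v0 v1] s0 N0 MN H; have [big|small] := lerP 1 (v + v * s).
  by apply: (le_trans MN); rewrite ler_peMl // ltW.
rewrite leNgt; apply/negP => bad.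
set sg := s * v in H; have sgE : v * s = sg by rewrite mulrC.
rewrite sgE in bad small.
have sg0 : 0 <= sg by rewrite mulr_ge0 // ltW.
have sat := @saturation_le R sg ltac:(apply/andP; split; lra).
set eta := 1 - expR _ in H sat.
have eta0 : 0 <= eta by rewrite subr_ge0 expR_le1; lra.
have eta1 : eta <= 1 by rewrite lerBlDr lerDl expR_ge0.
(* Arithmetic-geometric mean for [8 (1 - v)] and [1 + 8 (v + sg)], whose sum [9 + 8 sg] no longer
   depends on [v]. *)
have am : (1 - v) * (1 + 8 * (v + sg)) <= (9 + 8 * sg) ^+ 2 / 32.
  have := sqr_ge0 (8 * (1 - v) - (1 + 8 * (v + sg))); nra.
have key : (1 - v) * eta * (1 + 8 * (v + sg)) <= 9 * sg.
  have := ler_wpM2r eta0 am; nra.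
set x := (1 - v) * eta in H key.
have x1 : 0 <= x <= 1 by apply/andP; split; rewrite /x; nra.
case/andP: x1 => x0 x1.
have : 0 < (1 - 8 / 9 * x) * (M - (v + sg) * N).
  by rewrite mulr_gt0 //; lra.
have := ler_wpM2r (ltW N0) key.
lra.
Qed.

(** If [D' <= D], replacing [A'] by [2 v - A] leaves [v (e + e') + (A - v)(e - e')] with
    [e = exp (s D)] and [e' = exp (s D')]. Only the last term is not symmetric; it is controlled by
    [A - v <= (1 - v) max A 0], from [A <= 1], and by the relative drop of the weight, since
    [D - D' <= 3 v]. *)
Lemma exchange_pair_le (R : realType) (v s A A' D D' : R) :
  0 <= v <= 1 -> 0 <= s -> A <= 1 -> A' <= 1 -> A + A' <= 2 * v ->
  `|D - D'| <= 3 * v ->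
  A * expR (s * D) + A' * expR (s * D') <=
    v * (expR (s * D) + expR (s * D')) +
    (1 - v) * (1 - expR (- (3 * (s * v)))) *
      (Num.max A 0 * expR (s * D) + Num.max A' 0 * expR (s * D')).
Proof.
move=> /andP[v0 v1] s0; set eta := 1 - expR _.
have eta0 : 0 <= eta.
  by rewrite subr_ge0 expR_le1 oppr_le0 !mulr_ge0.
wlog DD : A A' D D' / D' <= D => [wl A1 A1' AA dD|A1 A1' AA dD].
  have [DD|DD] := lerP D' D; first exact: wl.
  have := wl A' A D' D (ltW DD) A1' A1; rewrite addrC distrC => /(_ AA dD).
  lra.
set e := expR (s * D); set e' := expR (s * D').
have e0 : 0 < e by exact: expR_gt0.
have e0' : 0 < e' by exact: expR_gt0.
have ee : e - e' <= eta * e.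
  have : expR (- (3 * (s * v))) * e <= e'.
    rewrite /e /e' -expRD ler_expR.
    have : D - D' <= 3 * v by apply: le_trans dD; exact: ler_norm.
    nra.
  rewrite /eta; lra.
have e'e : e' <= e by rewrite ler_expR ler_wpM2l.
have [mA mA'] : 0 <= Num.max A 0 /\ 0 <= Num.max A' 0.
  by rewrite !le_max lexx !orbT.
have Am : A - v <= (1 - v) * Num.max A 0.
  by have [A0|A0] := lerP A 0; [lra|nra].
apply: (@le_trans _ _ (v * (e + e') + (1 - v) * eta * (Num.max A 0 * e))); last first.
  rewrite lerD2l; apply: ler_wpM2l.
    by apply: mulr_ge0 => //; rewrite subr_ge0.
  by rewrite lerDl; apply: mulr_ge0 => //; exact: ltW.
apply: (@le_trans _ _ (v * (e + e') + (A - v) * (e - e'))); first by nra.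
rewrite lerD2l.
apply: (@le_trans _ _ ((1 - v) * Num.max A 0 * (e - e'))).
  by rewrite ler_wpM2r // subr_ge0.
have -> : (1 - v) * eta * (Num.max A 0 * e) = (1 - v) * Num.max A 0 * (eta * e) by ring.
by rewrite ler_wpM2l // mulr_ge0 // subr_ge0.
Qed.

(** * Stability of the learner *)

Lemma innerC (R : realType) (V : hilbertType R) (u v : V) :
  inner u v = inner v u :> R.
Proof. by rewrite hermC expr0 mul1r. Qed.

Lemma innerDl (R : realType) (V : hilbertType R) (u v w : V) :
  inner (u + v) w = inner u w + inner v w :> R.
Proof. by rewrite linearDl. Qed.

Lemma innerNl (R : realType) (V : hilbertType R) (u w : V) :
  inner (- u) w = - inner u w :> R.
Proof. by rewrite linearNl. Qed.

Lemma innerBl (R : realType) (V : hilbertType R) (u v w : V) :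
  inner (u - v) w = inner u w - inner v w :> R.
Proof. by rewrite innerDl innerNl. Qed.

Lemma innerZl (R : realType) (V : hilbertType R) (a : R) (u w : V) :
  inner (a *: u) w = a * inner u w :> R.
Proof. by rewrite linearZl_LR. Qed.

Lemma innerBr (R : realType) (V : hilbertType R) (u v w : V) :
  inner w (u - v) = inner w u - inner w v :> R.
Proof. by rewrite !(innerC w) innerBl. Qed.

Lemma sqr_normD (R : realType) (V : hilbertType R) (u v : V) :
  `|u + v| ^+ 2 = `|u| ^+ 2 + 2 * inner u v + `|v| ^+ 2.
Proof.
rewrite !inner_normE innerDl !(innerC _ (u + v)) !innerDl (innerC v u); ring.
Qed.

Lemma sqr_normB (R : realType) (V : hilbertType R) (u v : V) :
  `|u - v| ^+ 2 = `|u| ^+ 2 - 2 * inner u v + `|v| ^+ 2.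
Proof. by rewrite sqr_normD innerC innerNl innerC normrN mulrN. Qed.

Lemma cauchy_schwarz (R : realType) (V : hilbertType R) (u v : V) :
  inner u v <= `|u| * `|v| :> R.
Proof.
have [->|v0] := eqVneq v 0; first by rewrite innerC linear0l normr0 mulr0.
have nv : 0 < `|v| by rewrite normr_gt0.
have : 0 <= `| (`|v|) *: u - (`|u|) *: v | ^+ 2 by exact: sqr_ge0.
rewrite sqr_normB innerZl (innerC u) innerZl (innerC v) !normrZ !normr_id.
have [->|u0] := eqVneq u 0; first by rewrite linear0l normr0 mul0r.
have nu : 0 < `|u| by rewrite normr_gt0.
move=> H; rewrite -(ler_pM2l (mulr_gt0 nu nv)); nra.
Qed.

Lemma sqr_norm_conv (R : realType) (V : hilbertType R) (t : R) (f g : V) :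
  `|(1 - t) *: f + t *: g| ^+ 2 =
  (1 - t) * `|f| ^+ 2 + t * `|g| ^+ 2 - t * (1 - t) * `|f - g| ^+ 2.
Proof.
rewrite [in LHS]sqr_normD [in RHS]sqr_normB innerZl (innerC f) innerZl (innerC g) !normrZ.
rewrite !exprMn !real_normK ?num_real //; ring.
Qed.

Lemma opnorm_ge (R : realType) (V : hilbertType R) (A : {linear V -> V}) (v : V) :
  continuous A -> `|A v| <= opnorm A * `|v|.
Proof.
move=> cA.
have [->|v0] := eqVneq v 0; first by rewrite linear0 !normr0 mulr0.
have nv : 0 < `|v| by rewrite normr_gt0.
rewrite -ler_pdivrMr // -[_ / _]/(`|A v| / `|v|).
have -> : `|A v| / `|v| = `|A (`|v|^-1 *: v)|.
  by rewrite linearZ normrZ mulrC gtr0_norm ?invr_gt0.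
apply: ub_le_sup; last first.
  exists (`|v|^-1 *: v) => //=.
  by rewrite normrZ gtr0_norm ?invr_gt0 // mulVf // gt_eqF.
have /bounded_funP /(_ 1) [M HM] : bounded_near A (nbhs 0).
  by apply: continuous_linear_bounded; exact: cA.
by exists M => _ /= [w w1 <-]; exact: HM.
Qed.

(** Quadratic growth at the minimizer: comparing [f] with [(1 - t) f + t g], the identity
    [sqr_norm_conv] leaves a gain [lam t (1 - t) |f - g|^2]; divide by [t] and let [t] tend to 0. *)
Lemma regularized_minimizer_le (R : realType) (V : hilbertType R)
    (l : V -> R) (lam : R) (f : V) : 0 < lam ->
  (forall (t : R) g h, 0 <= t <= 1 ->
    l ((1 - t) *: g + t *: h) <= (1 - t) * l g + t * l h) ->
  (forall g, l f + lam * `|f| ^+ 2 <= l g + lam * `|g| ^+ 2) ->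
  forall g, l f + lam * `|f| ^+ 2 + lam * `|g - f| ^+ 2 <= l g + lam * `|g| ^+ 2.
Proof.
move=> lam0 cl minf g; set n := `|g - f| ^+ 2.
have n0 : 0 <= n by exact: sqr_ge0.
apply/ler_addgt0Pr => e e0.
pose t : R := Num.min 1 (e / (lam * n + 1)).
have q0 : 0 < lam * n + 1 by rewrite ltr_wpDl // mulr_ge0 // ltW.
have t0 : 0 < t by rewrite lt_min ltr01 divr_gt0.
have t1 : t <= 1 by rewrite ge_min lexx.
have tn : t * (lam * n) <= e.
  have : t <= e / (lam * n + 1) by rewrite ge_min lexx orbT.
  rewrite ler_pdivlMr //; lra.
have t01 : 0 <= t <= 1 by rewrite (ltW t0) t1.
have := minf ((1 - t) *: f + t *: g); have := cl t f g t01.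
rewrite sqr_norm_conv distrC -/n => c1 c2.
have : t * (l f + lam * `|f| ^+ 2 + lam * n - t * (lam * n)) <=
   t * (l g + lam * `|g| ^+ 2) by lra.
rewrite ler_pM2l //; lra.
Qed.

(** Reproduce [f] at [x] in the direction [y = f(x)]. The feature [k] reproduces itself, so [|k|^2]
    is the inner product of [K(x,x) y] with [y], at most [kappa^2 |y|^2]. *)
Lemma feature_norm_le (R : realType) (X : Type) (Y H : hilbertType R)
    (ev : {linear H -> (X -> Y)}) (K : X -> X -> {linear Y -> Y}) (kappa : R)
    (HK : is_rkhs ev K) (kappa0 : 0 <= kappa)
    (Kb : forall x, opnorm (K x x) <= kappa ^+ 2) (f : H) (x : X) :
  `|ev f x| <= kappa * `|f|.
Proof.
have [k kE rep] := rkhs_reproducing HK x (ev f x).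
have kn : `|k| <= kappa * `|ev f x|.
  rewrite -ler_sqr ?nnegrE ?mulr_ge0 // inner_normE -rep kE.
  apply: (le_trans (cauchy_schwarz _ _)).
  rewrite exprMn [`|ev f x| ^+ 2]expr2 mulrA ler_wpM2r //.
  apply: (le_trans (opnorm_ge _ (rkhs_continuous HK (x1:=x) (x2:=x)))).
  by rewrite ler_wpM2r.
have [->|v0] := eqVneq (ev f x) 0; first by rewrite normr0 mulr_ge0.
have nv : 0 < `|ev f x| by rewrite normr_gt0.
rewrite -(ler_pM2r nv) -expr2 inner_normE rep.
apply: (le_trans (cauchy_schwarz _ _)).
by have := ler_wpM2l (normr_ge0 f) kn; lra.
Qed.

(** * The loss and stability under replacement of one sample point *)

Section loss.
Context {R : realType} {X : Type} {Y H : hilbertType R}.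
Variables (ev : {linear H -> (X -> Y)}) (eps lam kappa : R).
Hypothesis lam0 : 0 < lam.
Hypothesis kappa0 : 0 < kappa.
Hypothesis ev_le : forall f x, `|ev f x| <= kappa * `|f|.

Lemma svr_loss_lipschitz y f g x :
  svr_loss ev eps y f x - svr_loss ev eps y g x <= kappa * `|f - g|.
Proof.
have d : `|y - ev f x| - `|y - ev g x| <= kappa * `|f - g|.
  apply: (le_trans (lerB_dist _ _)).
  have evB : ev (f - g) x = ev f x - ev g x by rewrite linearB.
  have -> : y - ev f x - (y - ev g x) = - (ev (f - g) x).
    by rewrite evB !opprB addrC addrA subrK.
  by rewrite normrN.
rewrite /svr_loss.
have := ev_le (f - g) x => /(le_trans (normr_ge0 _)) d0.
have [a|a] := lerP (`|y - ev f x| - eps) 0;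
have [b|b] := lerP (`|y - ev g x| - eps) 0; lra.
Qed.

Lemma svr_loss_convex y x (t : R) f g : 0 <= t <= 1 ->
  svr_loss ev eps y ((1 - t) *: f + t *: g) x <=
  (1 - t) * svr_loss ev eps y f x + t * svr_loss ev eps y g x.
Proof.
move=> /andP[t0 t1]; rewrite /svr_loss.
have d : `|y - ev ((1 - t) *: f + t *: g) x| <=
    (1 - t) * `|y - ev f x| + t * `|y - ev g x|.
  have -> : y - ev ((1 - t) *: f + t *: g) x =
      (1 - t) *: (y - ev f x) + t *: (y - ev g x).
    rewrite linearD !linearZ /= -[((1 - t) *: ev f + t *: ev g) x]/
      ((1 - t) *: ev f x + t *: ev g x) !scalerBr addrACA -scalerDl subrK scale1r.
    by rewrite opprD.
  apply: (le_trans (ler_normD _ _)).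
  by rewrite !normrZ !ger0_norm // subr_ge0.
set a := `|y - ev f x| in d *; set b := `|y - ev g x| in d *.
have t1' : 0 <= 1 - t by lra.
rewrite ge_max; apply/andP; split; last first.
  by rewrite addr_ge0 // mulr_ge0 // le_max lexx orbT.
apply: (@le_trans _ _ ((1 - t) * (a - eps) + t * (b - eps))); first by lra.
by rewrite lerD // ler_wpM2l // le_max lexx.
Qed.

(** Subtracting the loss at 0 makes the bound [kappa |f|] uniform in the label, so that this part
    never refers to [Cy]. *)
Definition excess_loss (p : X * Y) (f : H) : R :=
  svr_loss ev eps p.2 f p.1 - svr_loss ev eps p.2 0 p.1.

Lemma excess_loss_lipschitz p f g :
  excess_loss p f - excess_loss p g <= kappa * `|f - g|.
Proof. by have := svr_loss_lipschitz p.2 f g p.1; rewrite /excess_loss; lra. Qed.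

Lemma excess_loss_norm p f : `|excess_loss p f| <= kappa * `|f|.
Proof.
rewrite ler_norml /excess_loss.
have := svr_loss_lipschitz p.2 f 0 p.1; have := svr_loss_lipschitz p.2 0 f p.1.
rewrite sub0r subr0 normrN => ? ?; apply/andP; split; lra.
Qed.

Variable m : nat.
Hypothesis m0 : (0 < m)%N.
Variable fZ : ('I_m -> X * Y) -> H.
Hypothesis fZ_min : svr_learner ev eps lam fZ.

Let v : R := m%:R^-1.

Lemma invm_gt0 : 0 < v.
Proof. by rewrite invr_gt0 ltr0n. Qed.

Let invmK : v * m%:R = 1.
Proof. by rewrite mulVf // pnatr_eq0 -lt0n. Qed.

Lemma empirical_risk_convex (z : 'I_m -> X * Y) (t : R) f g : 0 <= t <= 1 ->
  empirical_risk ev eps ((1 - t) *: f + t *: g) z <=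
  (1 - t) * empirical_risk ev eps f z + t * empirical_risk ev eps g z.
Proof.
move=> t01; rewrite /empirical_risk -/v !(mulrCA _ v) -mulrDr.
rewrite ler_wpM2l ?(ltW invm_gt0) // !mulr_sumr -big_split /=.
by apply: ler_sum => k _; exact: svr_loss_convex.
Qed.

Lemma empirical_risk_lipschitz (z : 'I_m -> X * Y) f g :
  empirical_risk ev eps f z - empirical_risk ev eps g z <= kappa * `|f - g|.
Proof.
rewrite /empirical_risk -/v -mulrBr -sumrB.
have -> : kappa * `|f - g| = v * \sum_(k < m) kappa * `|f - g|.
  by rewrite sumr_const card_ord -mulr_natr mulrCA invmK mulr1.
rewrite ler_wpM2l ?(ltW invm_gt0) //.
by apply: ler_sum => k _; exact: svr_loss_lipschitz.
Qed.

Lemma svr_learner_strong_min z g :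
  empirical_risk ev eps (fZ z) z + lam * `|fZ z| ^+ 2 + lam * `|g - fZ z| ^+ 2
  <= empirical_risk ev eps g z + lam * `|g| ^+ 2.
Proof.
apply: (regularized_minimizer_le (l := fun f => empirical_risk ev eps f z)) => //.
  by move=> t f h; exact: empirical_risk_convex.
by have [] := fZ_min z.
Qed.

Lemma empirical_excessE z f :
  v * \sum_(k < m) excess_loss (z k) f =
  empirical_risk ev eps f z - empirical_risk ev eps 0 z.
Proof. by rewrite /empirical_risk -/v -mulrBr -sumrB. Qed.

(** Comparison with [g = 0]. The factor 2 joins the penalty [lam |f|^2] of the minimizer and the
    quadratic growth [lam |0 - f|^2]. *)
Lemma svr_learner_excess_le z :
  v * \sum_(k < m) excess_loss (z k) (fZ z) <= - (2 * lam * `|fZ z| ^+ 2).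
Proof.
rewrite empirical_excessE; have := svr_learner_strong_min z 0.
by rewrite sub0r normrN normr0 expr0n /= mulr0; lra.
Qed.

(** The mean excess loss is at least [- kappa |f|], hence [2 lam |f|^2 <= kappa |f|]. No label bound
    enters, and the excess losses at [f_Z] are at most [b / 2] in absolute value. *)
Lemma svr_learner_norm_le z : `|fZ z| <= kappa / (2 * lam).
Proof.
have := svr_learner_excess_le z.
have : - (kappa * `|fZ z|) <= v * \sum_(k < m) excess_loss (z k) (fZ z).
  have -> : - (kappa * `|fZ z|) = v * \sum_(k < m) (- (kappa * `|fZ z|)).
    by rewrite sumr_const card_ord -mulr_natr mulrCA invmK mulr1.
  rewrite ler_wpM2l ?(ltW invm_gt0) // ler_sum // => k _.
  by have := excess_loss_norm (z k) (fZ z); rewrite ler_norml => /andP[].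
have := normr_ge0 (fZ z); set n := `|fZ z| => n0 h1 h2.
rewrite ler_pdivlMr ?mulr_gt0 //.
have [->|nn] := eqVneq n 0; first by rewrite mul0r ltW.
have np : 0 < n by rewrite lt_def nn.
by rewrite -(ler_pM2r np); lra.
Qed.

Variables (z : 'I_m -> X * Y) (j : 'I_m) (p : X * Y).
Let z' k := if k == j then p else z k.
Let f := fZ z.
Let f' := fZ z'.

Let emp_diff g : empirical_risk ev eps g z' - empirical_risk ev eps g z =
  v * (svr_loss ev eps p.2 g p.1 - svr_loss ev eps (z j).2 g (z j).1).
Proof.
rewrite /empirical_risk -/v -mulrBr -sumrB (bigD1 j) //= big1 ?addr0.
  by rewrite /z' eqxx.
by move=> k kj; rewrite /z' (negPf kj) subrr.
Qed.

(** Adding the quadratic growth inequalities of both minimizers cancels every sample term except the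
    replaced one, which is Lipschitz: [2 lam n^2 <= 2 v kappa n]. *)
Lemma replace_one_stability : `|f - f'| <= kappa / lam * v.
Proof.
have h1 := svr_learner_strong_min z f'; have h2 := svr_learner_strong_min z' f.
have e1 := emp_diff f; have e2 := emp_diff f'.
have l1 := svr_loss_lipschitz p.2 f f' p.1.
have l2 := svr_loss_lipschitz (z j).2 f' f (z j).1.
rewrite -/f -/f' in h1 h2; rewrite (distrC f' f) in h1 l2.
set n := `|f - f'| in h1 h2 l1 l2 *.
have v0 := invm_gt0.
have : 2 * lam * n ^+ 2 <= v * (2 * (kappa * n)).
  have := ler_wpM2l (ltW v0) (lerD l1 l2); lra.
have n0 : 0 <= n by exact: normr_ge0.
have [->|nn] := eqVneq n 0.
  by move=> _; rewrite mulr_ge0 ?(ltW v0) // divr_ge0 // ltW.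
have np : 0 < n by rewrite lt_def nn.
rewrite (mulrAC kappa) (ler_pdivlMr _ _ lam0) => h; rewrite -(ler_pM2r np).
have := ltW v0; nra.
Qed.

Let b : R := kappa ^+ 2 / lam.

Lemma kappa_stability : kappa * `|f - f'| <= b * v.
Proof.
have := ler_wpM2l (ltW kappa0) replace_one_stability.
by rewrite /b expr2 !mulrA.
Qed.

Lemma exchange_sum_le :
  (excess_loss p f - excess_loss (z j) f) +
  (excess_loss (z j) f' - excess_loss p f') <= 2 * (b * v).
Proof.
have l1 := excess_loss_lipschitz p f f'.
have l2 := excess_loss_lipschitz (z j) f' f; rewrite (distrC f' f) in l2.
have := kappa_stability; lra.
Qed.

Lemma kappa_norm_le (y : 'I_m -> X * Y) : kappa * `|fZ y| <= b / 2.
Proof.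
have := ler_wpM2l (ltW kappa0) (svr_learner_norm_le y).
suff -> : kappa * (kappa / (2 * lam)) = b / 2 by [].
by rewrite /b; field; rewrite gt_eqF.
Qed.

(** The replaced term changes by at most [b / 2 + b / 2]; each of the other [m - 1] terms changes by
    at most [b v], which adds up to less than [b]. *)
Lemma empirical_excess_stability :
  `|v * \sum_(k < m) excess_loss (z k) f - v * \sum_(k < m) excess_loss (z' k) f'|
  <= 2 * (b * v).
Proof.
have v0 := invm_gt0.
have b0 : 0 <= b by rewrite /b divr_ge0 ?sqr_ge0 // ltW.
rewrite -mulrBr -sumrB normrM gtr0_norm // mulrC.
rewrite mulrA ler_wpM2r ?(ltW v0) //.
apply: (le_trans (ler_norm_sum _ _ _)).
rewrite (bigD1 j) //=.
have -> : 2 * b = b + b by rewrite mulr_natl mulr2n.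
apply: lerD.
  apply: (le_trans (ler_normB _ _)).
  have := excess_loss_norm (z j) f; have := excess_loss_norm (z' j) f'.
  have := kappa_norm_le z; have := kappa_norm_le z'; rewrite -/f -/f'; lra.
have -> : b = b * v * m%:R by rewrite -mulrA /v mulVf ?mulr1 // pnatr_eq0 -lt0n.
apply: (@le_trans _ _ (\sum_(k < m) b * v)); last first.
  by rewrite sumr_const card_ord mulr_natr.
rewrite [leRHS](bigD1 j) //=.
apply: (@le_trans _ _ (\sum_(k < m | k != j) b * v)); last first.
  by rewrite lerDr mulr_ge0 // ltW.
apply: ler_sum => k kj; rewrite /z' (negPf kj).
apply: le_trans kappa_stability.
rewrite ler_norml.
have := excess_loss_lipschitz (z k) f f'.
have := excess_loss_lipschitz (z k) f' f; rewrite (distrC f' f) => ? ?.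
by apply/andP; split; lra.
Qed.

End loss.

(** * Measurability of the learner *)

(** Here [H] carries no sigma-algebra, so the learner is only reached through real functions. Each
    is written as the infimum or supremum of a sequence of measurable ones. *)
Lemma measurable_fun_inf_seq d (E : measurableType d) (R : realType)
    (g : E -> R) (u : nat -> E -> R) :
  (forall n, measurable_fun [set: E] (u n)) ->
  (forall n x, g x <= u n x) ->
  (forall x (e : R), 0 < e -> exists n, u n x < g x + e) ->
  measurable_fun [set: E] g.
Proof.
move=> mu gu ug; apply: (measurability _ (RGenInftyO.measurableE R)).
move=> /= _ [_ [r ->] <-]; rewrite setTI.
rewrite (_ : _ @^-1` _ = \bigcup_n (u n @^-1` `]-oo, r[)).
  by apply: bigcup_measurable => n _; rewrite -[X in measurable X]setTI; exact: mu.
apply/seteqP; split => x /=.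
  rewrite in_itv /= => gr.
  have /(ug x)[n un] : 0 < r - g x by rewrite subr_gt0.
  by exists n => //=; rewrite in_itv /=; lra.
move=> [n _ /=]; rewrite !in_itv /=; exact: le_lt_trans.
Qed.

Lemma measurable_fun_sup_seq d (E : measurableType d) (R : realType)
    (g : E -> R) (u : nat -> E -> R) :
  (forall n, measurable_fun [set: E] (u n)) ->
  (forall n x, u n x <= g x) ->
  (forall x (e : R), 0 < e -> exists n, g x - e < u n x) ->
  measurable_fun [set: E] g.
Proof.
move=> mu gu ug.
rewrite (_ : g = \- (\- g)); last by apply/funext => x /=; rewrite opprK.
apply: measurableT_comp => //.
apply: (@measurable_fun_inf_seq _ _ _ _ (fun n => \- u n)) => /=.
- by move=> n; exact: measurableT_comp.
- by move=> n x; rewrite lerN2.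
- by move=> x e /(ug x)[n un]; exists n; lra.
Qed.

Lemma borel_measurable_continuous (R : realType) (T : ptopologicalType)
    (g : T -> R) : continuous g -> measurable_fun [set: borel T] (g : borel T -> R).
Proof.
move=> cg; apply: (measurability _ (RGenInftyO.measurableE R)).
move=> /= _ [_ [r ->] <-]; rewrite setTI.
apply: sub_sigma_algebra; move/continuousP : cg; apply.
exact: interval_open.
Qed.

Lemma separable_dense_seq (R : realType) (V : normedModType R) :
  separable V -> exists h : nat -> V, forall x (e : R), 0 < e ->
    exists n, `|x - h n| < e.
Proof.
move=> [D /countable_injP[f finj] dD].
exists (fun n => xget 0 [set x | D x /\ f x = n]) => x e e0.
have [y [/= By Dy]] : (ball x e) `&` D !=set0.
  apply: dD; last exact: ball_open.
  by exists x; exact: ballxx.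
exists (f y); case: xgetP => [z zE [Dz fz]|/(_ y)/=]; last by case.
by rewrite (finj z y) ?inE //; move: By; rewrite -ball_normE.
Qed.

(** A dense sequence of [V] may miss the range of [k]. For every centre [h n] and radius
    [1 / (p + 1)] a point of [X] sent into that ball is chosen when there is one; the default
    [point] otherwise does no harm. *)
Lemma separable_range_seq (R : realType) (V : normedModType R)
    (X : pointedType) (k : X -> V) :
  separable V -> exists x_ : nat -> X, forall x (e : R), 0 < e ->
    exists n, `|k x - k (x_ n)| < e.
Proof.
move=> /separable_dense_seq[h hP].
pose S n p := [set x | `|k x - h n| < p.+1%:R^-1 :> R].
exists (fun i => if unpickle i is Some (n, p) then xget point (S n p) else point).
move=> x e e0.
have [p pe] : exists p, p.+1%:R^-1 < e / 2 :> R.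
  have e2 : 0 < e / 2 by rewrite divr_gt0.
  exists (Num.truncn (e / 2)^-1); rewrite invf_plt ?posrE ?ltr0n //.
  exact: truncnS_gt.
have [n hn] := hP (k x) (p.+1%:R^-1) ltac:(by rewrite invr_gt0 ltr0n).
exists (pickle (n, p)); rewrite pickleK.
case: xgetP => [y yE Sy|/(_ x)]; last by move/(_ hn).
rewrite (le_lt_trans (ler_distD (h n) _ _)) //.
rewrite (distrC (h n)) [ltRHS](splitr e) ltrD //; exact: lt_trans pe.
Qed.

Lemma inner_continuous (R : realType) (V : hilbertType R) (w : V) :
  continuous (fun v : V => inner v w : R).
Proof.
move=> v; apply/cvgrPdist_le => e e0; near=> u.
have : `|v - u| < e / (`|w| + 1).
  near: u; apply: cvgr_dist_lt => //; rewrite divr_gt0 // ltr_wpDl //.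
rewrite ltr_pdivlMr ?ltr_wpDl // => /ltW vu.
have vw : 0 <= `|v - u| by [].
rewrite -innerBl ler_norml.
have := cauchy_schwarz (v - u) w; have := cauchy_schwarz (- (v - u)) w.
rewrite innerNl normrN => ? ?; apply/andP; split; nra.
Unshelve. all: by end_near.
Qed.

(** Expanding [0 <= |U - h|^2] shows that [|U|^2] is the supremum of [2 inner U h - |h|^2] over a
    dense sequence of [h]. *)
Lemma measurable_norm_weak d (E : measurableType d) (R : realType)
    (V : hilbertType R) (U : E -> V) : separable V ->
  (forall w, measurable_fun [set: E] (fun e => inner (U e) w : R)) ->
  measurable_fun [set: E] (fun e => `|U e|).
Proof.
move=> /separable_dense_seq[h hP] mU.
rewrite (_ : (fun e => _) = fun e => Num.sqrt (`|U e| ^+ 2)); last first.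
  by apply/funext => e; rewrite sqrtr_sqr normr_id.
apply: (@measurableT_comp _ _ _ _ _ _ (@Num.sqrt R)).
  by apply: continuous_measurable_fun; exact: sqrt_continuous.
apply: (@measurable_fun_sup_seq _ _ _ _
  (fun n e => 2 * inner (U e) (h n) - `|h n| ^+ 2)).
- move=> n; apply: measurable_funB => //; apply: measurable_funM => //.
- move=> n x; have := sqr_ge0 `|U x - h n|; rewrite sqr_normB; lra.
- move=> x e e0; have [n hn] := hP (U x) (Num.sqrt e) ltac:(by rewrite sqrtr_gt0).
  exists n; have : `|U x - h n| ^+ 2 < e.
    rewrite -[X in _ < X](sqr_sqrtr (ltW e0)).
    by rewrite ltr_pXn2r ?nnegrE ?sqrtr_ge0.
  rewrite sqr_normB; lra.
Qed.

Section svr_measurability.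
Context {R : realType} {X : ptopologicalType} {Y H : hilbertType R}.
Variables (ev : {linear H -> (X -> Y)}) (K : X -> X -> {linear Y -> Y}).
Hypothesis Y_separable : separable Y.
Hypothesis H_separable : separable H.
Hypothesis HK : is_rkhs ev K.
Hypothesis K_measurable : forall y1 y2 : Y,
  measurable_fun [set: borel X * borel X]
    (fun x : borel X * borel X => inner (K x.1 x.2 y1) y2 : R).

(* The features k_{x,y} move measurably in x because their mutual distances are
   values of the kernel, and x |-> h(x) is Lipschitz along them. *)
Lemma measurable_ev_inner (h : H) (y : Y) :
  measurable_fun [set: borel X] (fun x : borel X => inner (ev h x) y : R).
Proof.
have /choice[k kP] : forall x, exists k : H, ev k = (fun x' => K x' x y) /\
    forall f : H, inner (ev f x) y = inner f k.
  by move=> x; have [k ? ?] := rkhs_reproducing HK x y; exists k.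
have kk x x' : inner (k x) (k x') = inner (K x' x y) y :> R.
  by rewrite -(kP x').2 (kP x).1.
have [x_ xP] := separable_range_seq k H_separable.
have mK x' : measurable_fun [set: borel X] (fun x : borel X => `|k x - k x'|).
  rewrite (_ : (fun x => _) = fun x : borel X => Num.sqrt
      (inner (K x x y) y - 2 * inner (K x' x y) y + inner (K x' x' y) y)).
    apply: (@measurableT_comp _ _ _ _ _ _ (@Num.sqrt R)).
      by apply: continuous_measurable_fun; exact: sqrt_continuous.
    apply: measurable_funD => //; apply: measurable_funB.
      apply: (measurableT_comp (K_measurable y y) (g := fun x : borel X => (x, x))).
      exact: measurable_fun_pair.
    apply: measurable_funM => //.
    have mp : measurable_fun [set: borel X] (fun x : borel X => (x' : borel X, x)).
      exact: measurable_fun_pair.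
    exact: (measurableT_comp (K_measurable y y) mp).
  apply/funext => x; rewrite -!kk -!inner_normE -sqr_normB sqrtr_sqr normr_id //.
apply: (@measurable_fun_inf_seq _ _ _ _
  (fun n (x : borel X) => inner (ev h (x_ n)) y + `|h| * `|k x - k (x_ n)|)).
- move=> n; apply: measurable_funD => //; exact: measurable_funM.
- move=> n x; rewrite !(kP _).2.
  have := cauchy_schwarz h (k x - k (x_ n)); rewrite innerBr; lra.
- move=> x e e0; have [n xn] := xP x (e / (2 * `|h| + 1)) ltac:(
    by rewrite divr_gt0 // ltr_wpDl // mulr_ge0).
  have h1 : 0 < 2 * `|h| + 1 by rewrite ltr_wpDl // mulr_ge0.
  exists n; move: xn; rewrite (ltr_pdivlMr _ _ h1) => xn.
  rewrite !(kP _).2.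
  have := cauchy_schwarz h (k (x_ n) - k x); rewrite innerBr distrC.
  have := normr_ge0 (k x - k (x_ n)); have := normr_ge0 h; nra.
Qed.

Variables (eps lam kappa : R).
Hypothesis lam0 : 0 < lam.
Hypothesis kappa0 : 0 < kappa.
Hypothesis ev_le : forall f x, `|ev f x| <= kappa * `|f|.

Lemma measurable_svr_loss_fixed (h : H) :
  measurable_fun [set: borel X * borel Y]
    (fun p : borel X * borel Y => svr_loss ev eps p.2 h p.1).
Proof.
apply: measurable_maxr => //; apply: measurable_funB => //.
apply: measurable_norm_weak => // w.
rewrite (_ : (fun p => _) = fun p : borel X * borel Y =>
    inner (p.2 : Y) w - inner (ev h p.1) w); last first.
  by apply/funext => p; rewrite innerBl.
apply: measurable_funB.
  apply: (@measurableT_comp _ _ _ _ _ _ (fun y : borel Y => inner (y : Y) w : R)) => //.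
  by apply: borel_measurable_continuous; exact: inner_continuous.
apply: (@measurableT_comp _ _ _ _ _ _ (fun x : borel X => inner (ev h x) w : R)) => //.
exact: measurable_ev_inner.
Qed.

Variable m : nat.
Hypothesis m0 : (0 < m)%N.
Variable fZ : ('I_m -> X * Y) -> H.
Hypothesis fZ_min : svr_learner ev eps lam fZ.

Variables (d : measure_display) (E : measurableType d).
Variable z : 'I_m -> E -> borel X * borel Y.
Hypothesis mz : forall k, measurable_fun [set: E] (z k).
Let zs e : 'I_m -> X * Y := z^~ e.

Lemma measurable_empirical_risk_fixed h :
  measurable_fun [set: E] (fun e => empirical_risk ev eps h (zs e)).
Proof.
apply: measurable_funM => //; apply: measurable_sum => k.
exact: (measurableT_comp (measurable_svr_loss_fixed h) (mz k)).
Qed.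

Let F e h := svr_objective ev eps lam (zs e) h.

Let measurable_F h : measurable_fun [set: E] (F^~ h).
Proof. by apply: measurable_funD => //; exact: measurable_empirical_risk_fixed. Qed.

Let F_approx e (n : nat -> H) : (forall x (r : R), 0 < r -> exists i, `|x - n i| < r) ->
  forall f (r s : R), 0 < r -> 0 < s ->
  exists i, `|f - n i| < s /\ F e (n i) < F e f + r.
Proof.
move=> nP f r s r0 s0.
(* A Lipschitz constant of the objective at [f] within distance 1, whence the cap by 1 in the choice
   of [i]. *)
pose c := kappa + lam * (2 * `|f| + 1).
have c0 : 0 < c by rewrite /c ltr_wpDr // mulr_ge0 ?(ltW lam0) // addr_ge0 // mulr_ge0.
have rc0 : 0 < r / c by rewrite divr_gt0.
have [i] := nP f (Num.min s (Num.min 1 (r / c))) ltac:(by rewrite !lt_min s0 ltr01).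
rewrite !lt_min => /and3P[fs f1]; rewrite ltr_pdivlMr // => fr.
exists i; split => //; rewrite /F /svr_objective.
have L := empirical_risk_lipschitz eps ev_le m0 (zs e) (n i) f.
rewrite (distrC (n i)) in L.
have tri : `|n i| <= `|f| + `|f - n i|.
  by have := ler_normB f (f - n i); rewrite opprB addrC subrK.
have := normr_ge0 (f - n i); have := normr_ge0 f; have := normr_ge0 (n i).
set q := `|f - n i| in L tri f1 fr *; set a := `|f| in c c0 rc0 fr tri *.
set b := `|n i| in tri * => b0 a0 q0.
have sq : b ^+ 2 - a ^+ 2 <= q * (2 * a + 1).
  have : b ^+ 2 <= (a + q) ^+ 2 by rewrite ler_pXn2r // nnegrE addr_ge0.
  nra.
have := ler_wpM2l (ltW lam0) sq.
rewrite /c in fr; nra.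
Qed.

Let minF e g : F e (fZ (zs e)) + lam * `|g - fZ (zs e)| ^+ 2 <= F e g.
Proof. by have := svr_learner_strong_min lam0 m0 fZ_min (zs e) g; rewrite /F /svr_objective; lra. Qed.

Let V e := F e (fZ (zs e)).

Let V_le e g : V e <= F e g.
Proof.
apply: le_trans (minF e g); rewrite lerDl; apply: mulr_ge0; [exact: ltW|exact: sqr_ge0].
Qed.

Let measurable_V : measurable_fun [set: E] V.
Proof.
have [h hP] := separable_dense_seq H_separable.
apply: (@measurable_fun_inf_seq _ _ _ _ (fun n e => F e (h n))).
- by move=> n; exact: measurable_F.
- by move=> n e; exact: V_le.
move=> e r r0; have [i [_ hi]] := F_approx e hP (fZ (zs e)) r0 r0.
by exists i.
Qed.

(* Strong convexity makes the penalized distances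
   inf_n |h_n - h| + p (F(h_n) - min F) increase to |fZ - h|. *)
Lemma measurable_svr_learner_dist (g : H) :
  measurable_fun [set: E] (fun e => `|fZ (zs e) - g|).
Proof.
have [h hP] := separable_dense_seq H_separable.
pose u (p n : nat) e := `|h n - g| + p.+1%:R * (F e (h n) - V e).
have u0 p n e : 0 <= u p n e.
  by rewrite /u; apply: addr_ge0 => //; apply: mulr_ge0 => //; rewrite subr_ge0; exact: V_le.
pose G p e := inf [set u p n e | n in [set: nat]].
have hasinf p e : has_inf [set u p n e | n in [set: nat]].
  split; first by exists (u p 0%N e), 0%N.
  by exists 0 => _ [n _ <-].
have mG p : measurable_fun [set: E] (G p).
  apply: (@measurable_fun_inf_seq _ _ _ _ (u p)) => //.
  - move=> n; apply: measurable_funD; first exact: measurable_cst.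
    apply: measurable_funM; first exact: measurable_cst.
    by apply: measurable_funB; [exact: measurable_F|exact: measurable_V].
  - by move=> n e; apply: ge_inf; [exact: (hasinf p e).2|exists n].
  - by move=> e r r0; have [_ [n _ <-]] := inf_adherent r0 (hasinf p e); exists n.
apply: (@measurable_fun_sup_seq _ _ _ _ G) => //.
- move=> p e; apply/ler_addgt0Pr => r r0.
  have p0 : (0 : R) < p.+1%:R by rewrite ltr0n.
  have [||i [fi Fi]] := F_approx e hP (fZ (zs e)) (r := r / 2 / p.+1%:R) (s := r / 2).
  + by rewrite !divr_gt0.
  + by rewrite divr_gt0.
  apply: (@le_trans _ _ (u p i e)).
    by apply: ge_inf; [exact: (hasinf p e).2|exists i].
  have a1 : p.+1%:R * (F e (h i) - V e) <= r / 2.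
    by rewrite mulrC -ler_pdivlMr // lerBlDl ltW.
  have a2 : `|h i - g| <= `|h i - fZ (zs e)| + `|fZ (zs e) - g|.
    exact: ler_distD.
  rewrite (distrC (h i) (fZ _)) in a2; rewrite /u; lra.
- move=> e r r0.
  (* The maximum over [y] of [y - (p + 1) lam y^2] is [q = 1 / (4 lam (p + 1))]. It bounds how far
     the penalized infimum can fall below the true distance, and this [p] makes it smaller than
     [r]. *)
  pose p := Num.truncn (4 * lam * r)^-1.
  have lr : 0 < 4 * lam * r by rewrite !mulr_gt0.
  exists p; set x := `|fZ (zs e) - g|.
  have p0 : (0 : R) < p.+1%:R by rewrite ltr0n.
  have pE : (4 * lam * r)^-1 < p.+1%:R by exact: truncnS_gt.
  have key : 1 < 4 * lam * r * p.+1%:R by rewrite mulrC -ltr_pdivrMr // div1r.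
  pose q := (4 * lam * p.+1%:R)^-1.
  have lp : 0 < 4 * lam * p.+1%:R by rewrite !mulr_gt0.
  have qr : q < r by rewrite /q -div1r ltr_pdivrMr //; lra.
  apply: (@lt_le_trans _ _ (x - q)); first by lra.
  apply: lb_le_inf; first by exists (u p 0%N e), 0%N.
  move=> _ [n _ <-]; rewrite /u.
  have t1 : x <= `|h n - fZ (zs e)| + `|h n - g|.
    by rewrite (distrC (h n) (fZ _)) /x; exact: ler_distD.
  have t2 : lam * `|h n - fZ (zs e)| ^+ 2 <= F e (h n) - V e.
    by have := minF e (h n); rewrite /V; lra.
  set y := `|h n - fZ (zs e)| in t1 t2.
  have t3 : y - q <= p.+1%:R * (lam * y ^+ 2).
    have qq : q * (4 * lam * p.+1%:R) = 1 by rewrite /q mulVf // gt_eqF.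
    have E1 : p.+1%:R * (lam * y ^+ 2) - (y - q) * (q * (4 * lam * p.+1%:R)) =
      p.+1%:R * (lam * (y - 2 * q) ^+ 2) by ring.
    rewrite qq mulr1 in E1; rewrite -subr_ge0 E1.
    by rewrite mulr_ge0 ?(ltW p0) // mulr_ge0 ?(ltW lam0) ?sqr_ge0.
  have := ler_wpM2l (ltW p0) t2; lra.
Qed.

(** A [kappa]-Lipschitz function of [f] is the infimum of [Psi (h n) + kappa |f - h n|] over a dense
    sequence, as in McShane's extension formula. Only the distances depend on the learner. *)
Lemma measurable_lipschitz_learner (Psi : E -> H -> R) :
  (forall h, measurable_fun [set: E] (Psi^~ h)) ->
  (forall e f g, Psi e f - Psi e g <= kappa * `|f - g|) ->
  measurable_fun [set: E] (fun e => Psi e (fZ (zs e))).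
Proof.
move=> mPsi lip; have [h hP] := separable_dense_seq H_separable.
apply: (@measurable_fun_inf_seq _ _ _ _
  (fun n e => Psi e (h n) + kappa * `|fZ (zs e) - h n|)).
- move=> n; apply: measurable_funD => //; apply: measurable_funM => //.
  exact: measurable_svr_learner_dist.
- by move=> n e; have := lip e (fZ (zs e)) (h n); lra.
- move=> e r r0.
  have [n hn] := hP (fZ (zs e)) (r / (2 * kappa)) ltac:(by rewrite divr_gt0 // mulr_gt0).
  exists n; have := lip e (h n) (fZ (zs e)); rewrite (distrC (h n)).
  by move: hn; rewrite ltr_pdivlMr ?mulr_gt0 //; lra.
Qed.

Lemma measurable_excess_loss_learner (p : E -> borel X * borel Y) :
  measurable_fun [set: E] p ->
  measurable_fun [set: E] (fun e => excess_loss ev eps (p e) (fZ (zs e))).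
Proof.
move=> mp; apply: (measurable_lipschitz_learner
  (Psi := fun e f => excess_loss ev eps (p e) f)) => [h|e f g].
  apply: measurable_funB.
    exact: (measurableT_comp (measurable_svr_loss_fixed h) mp).
  exact: (measurableT_comp (measurable_svr_loss_fixed 0) mp).
exact: excess_loss_lipschitz.
Qed.

End svr_measurability.

(** * Exchangeability *)

(** Boundedness everywhere, rather than almost everywhere, passes to sections and compositions, so
    Fubini and linearity of the integral come without integrability side conditions. *)
Definition bounded_measurable d (T : measurableType d) (R : realType)
    (f : T -> R) : Prop :=
  measurable_fun [set: T] f /\ exists M : R, forall x, `|f x| <= M.

Section bounded_measurable_closure.
Context d (T : measurableType d) (R : realType).
Implicit Types f g : T -> R.

Lemma bm_cst (c : R) : bounded_measurable (fun _ : T => c).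
Proof. by split; [exact: measurable_cst|exists `|c|]. Qed.

Lemma bmD f g : bounded_measurable f -> bounded_measurable g ->
  bounded_measurable (fun x => f x + g x).
Proof.
move=> [mf [M fM]] [mg [N gN]]; split; first exact: measurable_funD.
by exists (M + N) => x; rewrite (le_trans (ler_normD _ _)) // lerD.
Qed.

Lemma bmN f : bounded_measurable f -> bounded_measurable (fun x => - f x).
Proof.
move=> [mf [M fM]]; split; first exact: measurableT_comp.
by exists M => x; rewrite normrN.
Qed.

Lemma bmB f g : bounded_measurable f -> bounded_measurable g ->
  bounded_measurable (fun x => f x - g x).
Proof. by move=> bf bg; apply: bmD => //; exact: bmN. Qed.

Lemma bmM f g : bounded_measurable f -> bounded_measurable g ->
  bounded_measurable (fun x => f x * g x).
Proof.
move=> [mf [M fM]] [mg [N gN]]; split; first exact: measurable_funM.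
by exists (M * N) => x; rewrite normrM ler_pM.
Qed.

Lemma bmZ (c : R) f : bounded_measurable f -> bounded_measurable (fun x => c * f x).
Proof. by move=> bf; apply: bmM => //; exact: bm_cst. Qed.

Lemma bm_exp f : bounded_measurable f -> bounded_measurable (fun x => expR (f x)).
Proof.
move=> [mf [M fM]]; split; first exact: measurableT_comp.
exists (expR M) => x; rewrite gtr0_norm ?expR_gt0 // ler_expR.
exact: le_trans (ler_norm _) (fM x).
Qed.

Lemma bm_max0 f : bounded_measurable f ->
  bounded_measurable (fun x => Num.max (f x) 0).
Proof.
move=> [mf [M fM]]; split; first exact: measurable_maxr.
exists M => x; have := fM x; have [f0|f0] := lerP (f x) 0; last by [].
by rewrite normr0; apply: le_trans.
Qed.

Lemma bm_sum (I : Type) (s : seq I) (f : I -> T -> R) :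
  (forall i, bounded_measurable (f i)) ->
  bounded_measurable (fun x => \sum_(i <- s) f i x).
Proof.
move=> bf; elim: s => [|i s IH].
  by under eq_fun do rewrite big_nil; exact: bm_cst.
by under eq_fun do rewrite big_cons; exact: bmD.
Qed.

Lemma bm_prod (I : Type) (s : seq I) (P : pred I) (f : I -> T -> R) :
  (forall i, bounded_measurable (f i)) ->
  bounded_measurable (fun x => \prod_(i <- s | P i) f i x).
Proof.
move=> bf; elim: s => [|i s IH].
  by under eq_fun do rewrite big_nil; exact: bm_cst.
under eq_fun do rewrite big_cons.
by case: (P i) => //; exact: bmM.
Qed.

Lemma bm_comp d' (T' : measurableType d') (h : T' -> T) f :
  bounded_measurable f -> measurable_fun [set: T'] h ->
  bounded_measurable (fun x => f (h x)).
Proof.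
by move=> [mf [M fM]] mh; split; [exact: measurableT_comp|exists M => x].
Qed.

End bounded_measurable_closure.

Section bounded_expectation.
Context d (T : measurableType d) (R : realType) (P : probability T R).
Implicit Types f g : T -> R.

Lemma bm_integrable f : bounded_measurable f -> P.-integrable [set: T] (EFin \o f).
Proof.
move=> [mf [M fM]]; apply: measurable_bounded_integrable => //.
  by rewrite -[X in (X < _)%E]/(P setT) probability_setT ltry.
exists M; split; first exact: num_real.
by move=> N MN x _; exact: le_trans (fM x) (ltW MN).
Qed.

Lemma bm_integral_fin f : bounded_measurable f ->
  (\int[P]_x (f x)%:E)%E = (\int[P]_x f x)%:E.
Proof.
by move=> bf; rewrite /Rintegral fineK //; apply: integrable_fin_num => //; exact: bm_integrable.
Qed.

Lemma bm_int_cst (c : R) : \int[P]_x c = c.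
Proof. by rewrite Rintegral_cst // -[X in _ * X]/(fine (P setT)) probability_setT mulr1. Qed.

Lemma bm_intD f g : bounded_measurable f -> bounded_measurable g ->
  \int[P]_x (f x + g x) = \int[P]_x f x + \int[P]_x g x.
Proof. by move=> bf bg; rewrite RintegralD //; exact: bm_integrable. Qed.

Lemma bm_intB f g : bounded_measurable f -> bounded_measurable g ->
  \int[P]_x (f x - g x) = \int[P]_x f x - \int[P]_x g x.
Proof. by move=> bf bg; rewrite RintegralB //; exact: bm_integrable. Qed.

Lemma bm_intZ (c : R) f : bounded_measurable f ->
  \int[P]_x (c * f x) = c * \int[P]_x f x.
Proof. by move=> bf; rewrite RintegralZl //; exact: bm_integrable. Qed.

Lemma bm_int_le f g : bounded_measurable f -> bounded_measurable g ->
  (forall x, f x <= g x) -> \int[P]_x f x <= \int[P]_x g x.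
Proof. by move=> bf bg fg; apply: le_Rintegral => //; exact: bm_integrable. Qed.

Lemma bm_int_sum (I : Type) (s : seq I) (f : I -> T -> R) :
  (forall i, bounded_measurable (f i)) ->
  \int[P]_x (\sum_(i <- s) f i x) = \sum_(i <- s) \int[P]_x f i x.
Proof.
move=> bf; elim: s => [|i s IH].
  by rewrite big_nil; under eq_Rintegral do rewrite big_nil; rewrite bm_int_cst.
rewrite big_cons -IH -bm_intD //; last exact: bm_sum.
by apply: eq_Rintegral => x _; rewrite big_cons.
Qed.

Lemma bm_int_norm_le f (M : R) : bounded_measurable f ->
  (forall x, `|f x| <= M) -> `|\int[P]_x f x| <= M.
Proof.
move=> bf fM; rewrite ler_norml -{1}(bm_int_cst (- M)) -{2}(bm_int_cst M).
apply/andP; split; apply: bm_int_le => //; try exact: bm_cst.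
  by move=> x; have := fM x; rewrite ler_norml => /andP[].
by move=> x; have := fM x; rewrite ler_norml => /andP[].
Qed.

Lemma bm_int_exp_gt0 f : bounded_measurable f -> 0 < \int[P]_x expR (f x).
Proof.
move=> bf; have [mf [M fM]] := bf.
apply: (@lt_le_trans _ _ (\int[P]_x expR (- M))).
  by rewrite bm_int_cst expR_gt0.
apply: bm_int_le; [exact: bm_cst|exact: bm_exp|move=> x].
by rewrite ler_expR; have := fM x; rewrite ler_norml => /andP[].
Qed.

End bounded_expectation.

Lemma bm_fubini d (T : measurableType d) d' (T' : measurableType d')
    (R : realType) (P : probability T R) (Q : probability T' R)
    (f : T * T' -> R) : bounded_measurable f ->
  \int[(P \x Q)%E]_w f w = \int[P]_x \int[Q]_y f (x, y).
Proof.
move=> bf; have iF := bm_integrable (P \x Q)%E bf.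
rewrite {1}/Rintegral -integral12_prod_meas1 //.
rewrite /Rintegral; congr fine; apply: eq_integral => x _.
rewrite /fubini_F /= -/(Rintegral Q setT (fun y => f (x, y))) bm_integral_fin //.
apply: (@bm_comp _ _ _ _ _ (fun y => (x, y)) f bf).
exact: pair1_measurable.
Qed.

Lemma bm_fubini_measurable d (T : measurableType d) d' (T' : measurableType d')
    (R : realType) (P : probability T R) (Q : probability T' R)
    (f : T * T' -> R) : bounded_measurable f ->
  bounded_measurable (fun x => \int[Q]_y f (x, y)).
Proof.
move=> bf; have iF := bm_integrable (P \x Q)%E bf.
have bs x : bounded_measurable (fun y => f (x, y)).
  apply: (@bm_comp _ _ _ _ _ (fun y => (x, y)) f bf); exact: pair1_measurable.
split; last first.
  have [_ [M fM]] := bf; exists M => x.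
  by apply: bm_int_norm_le.
have := measurable_fubini_F iF; rewrite /fubini_F => mF.
apply/measurable_EFinP; rewrite (_ : _ \o _ = fun x => (\int[Q]_y (f (x, y))%:E)%E) //.
by apply/funext => x /=; rewrite bm_integral_fin.
Qed.

(** Measurable boxes form a pi-system. For finite [I] they generate the product sigma-algebra on
    [I -> T], and independence is a statement about them. *)
Definition cylinders d (T : measurableType d) (I : Type) : set (set (I -> T)) :=
  [set C | exists B : I -> set T,
     (forall i, measurable (B i)) /\ C = [set u | forall i, B i (u i)]].

Arguments cylinders {d} T I.

Notation famType T I := (g_sigma_algebraType (cylinders T I)).

Section families.
Context d (T : measurableType d) (I : finType).

Lemma measurable_family_coord (i : I) :
  measurable_fun [set: famType T I] (fun u : famType T I => u i).
Proof.
move=> _ B mB; rewrite setTI; apply: sub_sigma_algebra.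
exists (fun k => if k == i then B else setT); split.
  by move=> k; case: ifP.
apply/seteqP; split => u /=; first by move=> Bu k; case: eqP => [->|].
by move=> /(_ i); rewrite eqxx.
Qed.

Lemma measurable_family d' (E : measurableType d') (W : E -> I -> T) :
  (forall i, measurable_fun [set: E] (W^~ i)) ->
  measurable_fun [set: E] (W : E -> famType T I).
Proof.
move=> mW; apply: (@measurability _ _ _ (famType T I) _ _ (cylinders T I) erefl).
move=> _ [_ [B [mB ->]] <-]; rewrite setTI.
rewrite (_ : _ @^-1` _ = \bigcap_(i in [set: I]) (W^~ i @^-1` B i)).
  apply: fin_bigcap_measurable => // i _.
  by rewrite -[X in measurable X]setTI; exact: mW.
by apply/seteqP; split => e /=; [move=> h i _; exact: h|move=> h i; exact: h].
Qed.

Lemma cylinders_setI : setI_closed (cylinders T I).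
Proof.
move=> _ _ [A [mA ->]] [B [mB ->]]; exists (fun i => A i `&` B i); split.
  by move=> i; exact: measurableI.
by apply/seteqP; split => u /=; [move=> [a b] i; split|move=> ab; split => i; case: (ab i)].
Qed.

(** Two probability laws that agree on the pi-system of boxes agree everywhere; the integrals are
    then compared through the pushforwards. *)
Lemma family_law_eq (R : realType) d1 (E1 : measurableType d1)
    (P1 : probability E1 R) d2 (E2 : measurableType d2) (P2 : probability E2 R)
    (W1 : E1 -> I -> T) (W2 : E2 -> I -> T) (Phi : famType T I -> R) :
  (forall i, measurable_fun [set: E1] (W1^~ i)) ->
  (forall i, measurable_fun [set: E2] (W2^~ i)) ->
  (forall B : I -> set T, (forall i, measurable (B i)) ->
     P1 [set w | forall i, B i (W1 w i)] = P2 [set w | forall i, B i (W2 w i)]) ->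
  bounded_measurable Phi ->
  \int[P1]_w Phi (W1 w) = \int[P2]_w Phi (W2 w).
Proof.
move=> mW1 mW2 law bPhi.
have m1 := measurable_family mW1; have m2 := measurable_family mW2.
pose f1 : {mfun E1 >-> famType T I} := mfun_Sub (mem_set m1).
pose f2 : {mfun E2 >-> famType T I} := mfun_Sub (mem_set m2).
have eqm A : measurable A -> pushforward P1 f1 A = pushforward P2 f2 A.
  apply: (@measure_unique _ R (famType T I) (cylinders T I) (fun _ => setT) erefl).
  - exact: cylinders_setI.
  - move=> _; exists (fun _ => setT); split => //.
    by apply/seteqP; split.
  - by rewrite bigcup_const //; exists 0%N.
  - by move=> _ [B [mB ->]]; exact: law.
  - by move=> _; rewrite -[X in (X < _)%E]/(P1 setT) probability_setT ltry.
rewrite /Rintegral; congr fine.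
have i1 : P1.-integrable (f1 @^-1` setT) ((EFin \o Phi) \o f1).
  by apply: (bm_integrable P1 (f := Phi \o f1)); exact: bm_comp.
have i2 : P2.-integrable (f2 @^-1` setT) ((EFin \o Phi) \o f2).
  by apply: (bm_integrable P2 (f := Phi \o f2)); exact: bm_comp.
have mPhi : measurable_fun [set: famType T I] (EFin \o Phi).
  by apply/measurable_EFinP; exact: bPhi.1.
have e1 := integral_pushforward m1 mPhi i1 measurableT.
have e2 := integral_pushforward m2 mPhi i2 measurableT.
transitivity (\int[pushforward P1 f1]_y (EFin \o Phi) y)%E; first by rewrite e1.
transitivity (\int[pushforward P2 f2]_y (EFin \o Phi) y)%E; last by rewrite e2.
by apply: eq_measure_integral => A mA _; exact: eqm.
Qed.

End families.

(** * The sample together with a ghost point *)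

Section iid_sample.
Context d (Omega : measurableType d) d' (T : measurableType d') (R : realType).
Variables (P : probability Omega R) (m : nat).
Variables (XY : Omega -> T) (Z : 'I_m -> Omega -> T).
Hypothesis mXY : measurable_fun [set: Omega] XY.
Hypothesis mZ : forall k, measurable_fun [set: Omega] (Z k).
Hypothesis iid : forall B : 'I_m -> set T, (forall k, measurable (B k)) ->
  P [set w | forall k, B k (Z k w)] = (\prod_(k < m) P (XY @^-1` B k))%E.

(** Reading [XY] on a second copy of [Omega] makes it a point independent of the whole sample;
    integrating over [w.2] is the expectation over a new pair with the sample fixed. *)
Definition sample_ghost (w : Omega * Omega) : option 'I_m -> T :=
  fun o => if o is Some k then Z k w.1 else XY w.2.

Lemma measurable_sample_ghost o :
  measurable_fun [set: Omega * Omega] (sample_ghost^~ o).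
Proof.
case: o => [k|] /=.
  by apply: (measurableT_comp (mZ k)).
by apply: (measurableT_comp mXY).
Qed.

Let mB_pre B (mB : measurable B) : measurable (XY @^-1` B).
Proof. by rewrite -[X in measurable X]setTI; exact: mXY. Qed.

Lemma sample_ghost_law (B : option 'I_m -> set T) : (forall o, measurable (B o)) ->
  (P \x P)%E [set w | forall o, B o (sample_ghost w o)] =
  (\prod_(o : option 'I_m) P (XY @^-1` B o))%E.
Proof.
move=> mB.
rewrite (_ : [set w | _] = [set w | forall k, B (Some k) (Z k w)] `*` (XY @^-1` B None)).
  rewrite product_measure1E; last 2 first.
  - rewrite (_ : [set w | _] = \bigcap_(k in [set: 'I_m]) (Z k @^-1` B (Some k))).
      apply: fin_bigcap_measurable => // k _.
      by rewrite -[X in measurable X]setTI; exact: mZ.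
    by apply/seteqP; split => e /=; [move=> h i _; exact: h|move=> h i; exact: h].
  - exact: mB_pre.
  transitivity ((\prod_(k < m) P (XY @^-1` B (Some k))) * P (XY @^-1` B None))%E.
    by congr (_ * _)%E; exact: (iid (fun k => mB (Some k))).
  rewrite [RHS](bigD1 None) //= muleC; congr (_ * _)%E.
  rewrite (reindex_omap Some id) /=; last by case.
  by apply: eq_bigl => k; rewrite eqxx.
apply/seteqP; split => -[w w'] /=.
  by move=> h; split; [move=> k; exact: (h (Some k))|exact: (h None)].
by move=> [h h'] [k|].
Qed.

(** The law is a product of [m + 1] equal factors, so permuting the indices only reorders the
    product. *)
Lemma sample_ghost_exchangeable (s : option 'I_m -> option 'I_m)
    (Phi : famType T (option 'I_m) -> R) :
  involutive s -> bounded_measurable Phi ->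
  \int[(P \x P)%E]_w Phi (sample_ghost w) =
  \int[(P \x P)%E]_w Phi (fun o => sample_ghost w (s o)).
Proof.
move=> sK; apply: family_law_eq.
- exact: measurable_sample_ghost.
- by move=> o; exact: measurable_sample_ghost.
- move=> B mB; apply: (etrans (sample_ghost_law mB)).
  rewrite (_ : [set w | forall i, B i (sample_ghost w (s i))] =
    [set w | forall o, B (s o) (sample_ghost w o)]).
    rewrite (reindex_inj (inv_inj sK)).
    by apply/esym; exact: (sample_ghost_law (fun o => mB (s o))).
  apply/seteqP; split => w /= h o; first by have := h (s o); rewrite sK.
  by have := h (s o); rewrite sK.
Qed.

End iid_sample.

(** * Moment generating functions *)

Definition ghost_swap m (j : 'I_m) (o : option 'I_m) : option 'I_m :=
  if o == Some j then None else if o == None then Some j else o.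

Lemma ghost_swapK m (j : 'I_m) : involutive (ghost_swap j).
Proof.
move=> [k|]; rewrite /ghost_swap /=; last by rewrite eqxx.
by case: (eqVneq (Some k) (Some j)) => [->|kj] //=; rewrite (negPf kj).
Qed.

Section iid_deviation.
Context d (Omega : measurableType d) d' (T : measurableType d') (R : realType).
Variables (P : probability Omega R) (m : nat).
Variables (XY : Omega -> T) (Z : 'I_m -> Omega -> T).
Hypothesis mXY : measurable_fun [set: Omega] XY.
Hypothesis mZ : forall k, measurable_fun [set: Omega] (Z k).
Hypothesis iid : forall B : 'I_m -> set T, (forall k, measurable (B k)) ->
  P [set w | forall k, B k (Z k w)] = (\prod_(k < m) P (XY @^-1` B k))%E.

(** Factors are split off one at a time: exchanging the sample point [j] with the ghost moves its
    factor to the second coordinate, where Fubini separates it. *)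
Lemma iid_expectation_prod (g : T -> R) : bounded_measurable g ->
  \int[P]_w (\prod_(k < m) g (Z k w)) = (\int[P]_w g (XY w)) ^+ m.
Proof.
move=> bg.
have bgc (u : option 'I_m) : bounded_measurable
    (fun x : famType T (option 'I_m) => g (x u)).
  exact: (bm_comp bg (measurable_family_coord u)).
have bgZ k : bounded_measurable (fun w => g (Z k w)) by exact: bm_comp.
have bgX : bounded_measurable (fun w => g (XY w)) by exact: bm_comp.
suff H i : (i <= m)%N -> \int[P]_w (\prod_(k < m | (k < i)%N) g (Z k w)) =
    (\int[P]_w g (XY w)) ^+ i.
  rewrite -H //; apply: eq_Rintegral => w _; apply: eq_bigl => k.
  by rewrite ltn_ord.
elim: i => [|i IH] im.
  rewrite expr0 -[RHS](bm_int_cst P); apply: eq_Rintegral => w _.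
  by rewrite big_pred0.
pose j := Ordinal im.
pose Phi (u : famType T (option 'I_m)) : R :=
  (\prod_(k < m | (k < i)%N) g (u (Some k))) * g (u (Some j)).
have bPhi : bounded_measurable Phi by apply: bmM => //; exact: bm_prod.
have e1 w : \prod_(k < m | (k < i.+1)%N) g (Z k w) =
    (\prod_(k < m | (k < i)%N) g (Z k w)) * g (Z j w).
  rewrite (bigD1 j) //= mulrC; congr (_ * _); apply: eq_bigl => k.
  by rewrite ltnS [RHS]ltn_neqAle andbC -val_eqE.
have bprod : bounded_measurable (fun w => \prod_(k < m | (k < i)%N) g (Z k w)).
  exact: bm_prod.
have b1 : bounded_measurable (fun w : Omega * Omega => Phi (sample_ghost XY Z w)).
  apply: bm_comp bPhi _; apply: measurable_family; exact: measurable_sample_ghost.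
transitivity (\int[(P \x P)%E]_w Phi (sample_ghost XY Z w)).
  rewrite bm_fubini //; apply: eq_Rintegral => w _.
  by rewrite e1 -[LHS](bm_int_cst P); apply: eq_Rintegral.
rewrite (sample_ghost_exchangeable mXY mZ iid (ghost_swapK j) bPhi).
transitivity (\int[(P \x P)%E]_w
    ((\prod_(k < m | (k < i)%N) g (Z k w.1)) * g (XY w.2))).
  apply: eq_Rintegral => w _; rewrite /Phi; congr (_ * _); last first.
    by rewrite /ghost_swap eqxx.
  apply: eq_bigr => k ki; congr g; rewrite /ghost_swap /=.
  case: eqP => // -[kj]; move: ki; by rewrite kj /= ltnn.
have b2 : bounded_measurable (fun w : Omega * Omega =>
    (\prod_(k < m | (k < i)%N) g (Z k w.1)) * g (XY w.2)).
  by apply: bmM; [exact: (bm_comp bprod measurable_fst)|exact: (bm_comp bgX measurable_snd)].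
rewrite bm_fubini // exprSr -IH ?(ltnW im) //.
under eq_Rintegral do rewrite /= bm_intZ //.
rewrite -[RHS]mulrC -bm_intZ //.
by apply: eq_Rintegral => w _; rewrite mulrC.
Qed.

(** On [[0, C]] the exponential lies below its chord, whose mean depends only on the mean of [c].
    The extremal law is thus carried by 0 and [C], with mass [p = mu / C] at [C], which is the case
    of [two_point_mgf_le]. *)
Lemma hoeffding_sample_mean (c : T -> R) (C t : R) : (0 < m)%N ->
  measurable_fun [set: T] c -> (forall x, 0 <= c x <= C) -> 0 < C -> 0 <= t ->
  \int[P]_w expR (t * (\int[P]_x c (XY x) - m%:R^-1 * \sum_(k < m) c (Z k w))) <=
  expR (m%:R^-1 * (t ^+ 2 * C ^+ 2 / 8)).
Proof.
move=> m0 mc c01 C0 t0; set mu := \int[P]_x c (XY x); set v : R := m%:R^-1.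
have mr : (m%:R : R) != 0 by rewrite pnatr_eq0 -lt0n.
have v0 : 0 < v by rewrite invr_gt0 ltr0n.
have bc : bounded_measurable c.
  by split => //; exists C => x; have /andP[h1 h2] := c01 x; rewrite ger0_norm.
have bcX : bounded_measurable (fun w => c (XY w)) by exact: bm_comp.
pose h := t * v * C.
have h0 : 0 <= h by rewrite !mulr_ge0 // ltW.
pose g x := expR (t * v * (mu - c x)).
have bg : bounded_measurable g.
  by apply: bm_exp; apply: bmZ; apply: bmB => //; exact: bm_cst.
have -> : \int[P]_w expR (t * (mu - v * \sum_(k < m) c (Z k w))) =
    \int[P]_w (\prod_(k < m) g (Z k w)).
  apply: eq_Rintegral => w _; rewrite /g -expR_sum; congr expR.
  rewrite -mulr_sumr sumrB sumr_const card_ord -mulr_natr -mulrA; congr (_ * _).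
  by rewrite mulrBr mulrCA mulVf // mulr1.
rewrite iid_expectation_prod //.
have -> : expR (v * (t ^+ 2 * C ^+ 2 / 8)) = expR (h ^+ 2 / 8) ^+ m.
  by rewrite -expRM_natl; congr expR; rewrite /h /v; field.
have ig : 0 <= \int[P]_w g (XY w).
  by apply: Rintegral_ge0 => w _; exact: expR_ge0.
rewrite ler_pXn2r ?nnegrE ?expR_ge0 //.
pose p := mu / C.
have muC : 0 <= mu <= C.
  rewrite -{1}(bm_int_cst P 0) -(bm_int_cst P C); apply/andP; split;
    apply: bm_int_le => //; try exact: bm_cst.
    by move=> w; have /andP[] := c01 (XY w).
  by move=> w; have /andP[] := c01 (XY w).
have p01 : 0 <= p <= 1.
  case/andP: muC => mu0 mu1; rewrite divr_ge0 ?(ltW C0) //=.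
  by rewrite ler_pdivrMr // mul1r.
apply: le_trans (two_point_mgf_le p01 h0).
have pC : p * C = mu by rewrite divfK // gt_eqF.
pose E := expR (p * h); pose F := expR (- h).
have EF : expR (- ((1 - p) * h)) = E * F.
  by rewrite -expRD; congr expR; ring.
have -> : (1 - p) * expR (p * h) + p * expR (- ((1 - p) * h)) =
    \int[P]_w (E + (E * (F - 1) / C) * c (XY w)).
  rewrite bm_intD; [|exact: bm_cst|exact: bmZ].
  by rewrite bm_int_cst bm_intZ // -/mu -pC EF -/E; field; rewrite gt_eqF.
apply: bm_int_le.
- by apply: bm_comp bg mXY.
- by apply: bmD; [exact: bm_cst|exact: bmZ].
move=> w; rewrite /g; set x := c (XY w); pose y := x / C.
have yC : y * C = x by rewrite divfK // gt_eqF.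
have y01 : 0 <= y <= 1.
  have /andP[x0 x1] := c01 (XY w); rewrite divr_ge0 ?(ltW C0) //=.
  by rewrite ler_pdivrMr // mul1r.
have -> : expR (t * v * (mu - x)) = E * expR (- (h * y)).
  by rewrite -expRD; congr expR; rewrite -pC -yC /h; ring.
have -> : E + E * (F - 1) / C * x = E * ((1 - y) + y * F).
  by rewrite -yC; field; rewrite gt_eqF.
rewrite ler_wpM2l ?expR_ge0 //.
have q0 := exp_increment_le 0 (- (h * y)); have q1 := exp_increment_le (- h) (- (h * y)).
rewrite expR0 in q0; case/andP: y01 => y0 y1.
have r0 := ler_wpM2l (x := 1 - y) ltac:(by rewrite subr_ge0) q0.
have r1 := ler_wpM2l y0 q1.
rewrite -/F in r1; lra.
Qed.

End iid_deviation.

(* [A j] compares the ghost point with the j-th sample point, the primed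
   quantities are the same after exchanging the two. Differentiating the moment
   generating function and symmetrizing under the exponentially tilted measure
   gives the constant 1, where bounded differences would only give 3 / 2. *)
Lemma exchangeable_mgf_le d (Omega : measurableType d) (R : realType)
    (P : probability Omega R) (m : nat) (D : Omega -> R)
    (A A' D' : 'I_m -> Omega * Omega -> R) (s : R) :
  forall v : R, v = m%:R^-1 -> (0 < m)%N -> bounded_measurable D ->
  (forall j, bounded_measurable (A j)) -> (forall j, bounded_measurable (A' j)) ->
  (forall j, bounded_measurable (D' j)) ->
  (forall j (u : R), \int[(P \x P)%E]_w (A j w * expR (u * D w.1)) =
     \int[(P \x P)%E]_w (A' j w * expR (u * D' j w))) ->
  (forall j (u : R), \int[(P \x P)%E]_w (Num.max (A j w) 0 * expR (u * D w.1)) =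
     \int[(P \x P)%E]_w (Num.max (A' j w) 0 * expR (u * D' j w))) ->
  (forall j (u : R), \int[(P \x P)%E]_w expR (u * D w.1) =
     \int[(P \x P)%E]_w expR (u * D' j w)) ->
  (forall w, D w = \int[P]_w' (v * \sum_(j < m) A j (w, w'))) ->
  (forall w, \int[P]_w' (v * \sum_(j < m) Num.max (A j (w, w')) 0) <=
     1 / 9 + 8 / 9 * D w) ->
  (forall w, D w <= 1) -> (forall j w, A j w <= 1) -> (forall j w, A' j w <= 1) ->
  (forall j w, A j w + A' j w <= 2 * v) ->
  (forall j w, `|D w.1 - D' j w| <= 3 * v) -> 0 <= s ->
  \int[P]_w expR (s * D w) <= expR (v * s + v * s ^+ 2 / 2).
Proof.
move=> v vE m0 bD bA bA' bD' HA HA0 HN DE DA D1 A1 A1' AA DD s0.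
have v0 : 0 < v by rewrite vE invr_gt0 ltr0n.
have v1 : v <= 1 by rewrite vE invf_le1 ?ltr0n // ler1n.
have v01 : 0 <= v <= 1 by rewrite ltW.
have be u : bounded_measurable (fun w => expR (u * D w)).
  by apply: bm_exp; exact: bmZ.
have bDe u : bounded_measurable (fun w => D w * expR (u * D w)) by exact: bmM.
have be1 u : bounded_measurable (fun w : Omega * Omega => expR (u * D w.1)).
  exact: (bm_comp (be u) measurable_fst).
have be' u j : bounded_measurable (fun w : Omega * Omega => expR (u * D' j w)).
  by apply: bm_exp; exact: bmZ.
have bA0 j : bounded_measurable (fun w => Num.max (A j w) 0) by exact: bm_max0.
have bA0' j : bounded_measurable (fun w => Num.max (A' j w) 0) by exact: bm_max0.
have bsec (F : Omega * Omega -> R) w : bounded_measurable F ->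
    bounded_measurable (fun w' => F (w, w')).
  by move=> bF; apply: (bm_comp bF); exact: pair1_measurable.
pose phi u := \int[P]_w expR (u * D w).
have phiE u : phi u = \int[(P \x P)%E]_w expR (u * D w.1).
  rewrite bm_fubini //; apply: eq_Rintegral => w _ /=.
  by rewrite bm_int_cst.
have avgE (F : 'I_m -> Omega * Omega -> R) u : (forall j, bounded_measurable (F j)) ->
    \int[P]_w ((\int[P]_w' (v * \sum_(j < m) F j (w, w'))) * expR (u * D w)) =
    v * \sum_(j < m) \int[(P \x P)%E]_w (F j w * expR (u * D w.1)).
  move=> bF.
  have bFe j : bounded_measurable (fun w => F j w * expR (u * D w.1)) by exact: bmM.
  rewrite -bm_int_sum // -bm_intZ; last exact: bm_sum.
  rewrite bm_fubini; last by apply: bmZ; exact: bm_sum.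
  apply: eq_Rintegral => w _ /=.
  have bS : bounded_measurable (fun w' => v * \sum_(j < m) F j (w, w')).
    by apply: bmZ; apply: bm_sum => j; exact: bsec.
  rewrite mulrC -bm_intZ //; apply: eq_Rintegral => w' _ /=.
  by rewrite -mulr_suml [LHS]mulrC -mulrA.
(* The tilted mean is kept multiplied by [phi u]. [SM] transfers the bound on the positive parts to
   the tilted measure, which brings [M] back on the right-hand side. *)
have mean u : 0 <= u -> \int[P]_w (D w * expR (u * D w)) <= (v + v * u) * phi u.
  move=> u0; set M := \int[P]_w _.
  set eta := 1 - expR (- (3 * (u * v))).
  pose IA j := \int[(P \x P)%E]_w (A j w * expR (u * D w.1)).
  pose IM j := \int[(P \x P)%E]_w (Num.max (A j w) 0 * expR (u * D w.1)).
  have ME : M = v * \sum_(j < m) IA j.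
    by rewrite -avgE //; apply: eq_Rintegral => w _; rewrite -DE.
  have SM : v * \sum_(j < m) IM j <= phi u / 9 + 8 / 9 * M.
    rewrite -avgE //.
    have -> : phi u / 9 + 8 / 9 * M =
        \int[P]_w (9^-1 * expR (u * D w) + 8 / 9 * (D w * expR (u * D w))).
      rewrite bm_intD; [|exact: bmZ|exact: bmZ].
      by rewrite !bm_intZ // [phi u / 9]mulrC.
    apply: bm_int_le => [||w].
    - apply: bmM => //; apply: (@bm_fubini_measurable _ _ _ _ _ P P
        (fun w => v * \sum_(j < m) Num.max (A j w) 0)).
      by apply: bmZ; exact: bm_sum.
    - by apply: bmD; exact: bmZ.
    - rewrite mulrA -mulrDl ler_wpM2r ?expR_ge0 //.
      by have := DA w; lra.
  (* Each integral equals its exchanged version, so twice the integral is that of the symmetrized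
     integrand, to which [exchange_pair_le] applies pointwise. *)
  have pair j : 2 * IA j <= 2 * v * phi u + 2 * (1 - v) * eta * IM j.
    have -> : 2 * IA j = \int[(P \x P)%E]_w
        (A j w * expR (u * D w.1) + A' j w * expR (u * D' j w)).
      by rewrite bm_intD; [rewrite -HA -/(IA j); ring|exact: bmM|exact: bmM].
    have -> : 2 * v * phi u + 2 * (1 - v) * eta * IM j = \int[(P \x P)%E]_w
        (v * (expR (u * D w.1) + expR (u * D' j w)) + (1 - v) * eta *
          (Num.max (A j w) 0 * expR (u * D w.1) +
           Num.max (A' j w) 0 * expR (u * D' j w))).
      rewrite bm_intD; [|by apply: bmZ; exact: bmD|by apply: bmZ; apply: bmD; exact: bmM].
      rewrite !bm_intZ; [|by apply: bmD; exact: bmM|exact: bmD].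
      rewrite !bm_intD //; [|exact: bmM|exact: bmM].
      by rewrite -HN -HA0 -/(IM j) -phiE; ring.
    apply: bm_int_le.
    - by apply: bmD; exact: bmM.
    - apply: bmD; first by apply: bmZ; exact: bmD.
      by apply: bmZ; apply: bmD; exact: bmM.
    - by move=> w; exact: exchange_pair_le.
  apply: tilted_mean_bound => //; first by rewrite v0.
  - exact: bm_int_exp_gt0 (bmZ _ bD).
  - apply: bm_int_le => // w.
    by rewrite ler_piMl ?expR_ge0.
  - have vm : v * m%:R = 1 by rewrite vE mulVf // pnatr_eq0 -lt0n.
    have pairs : \sum_(j < m) IA j <= \sum_(j < m) (v * phi u + (1 - v) * eta * IM j).
      by apply: ler_sum => j _; have := pair j; lra.
    rewrite big_split /= sumr_const card_ord -mulr_sumr -mulr_natr in pairs.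
    have := ler_wpM2l (ltW v0) pairs; rewrite -ME mulrDr.
    have -> : v * (v * phi u * m%:R) = v * phi u.
      by rewrite mulrCA vm mulr1.
    move/le_trans; apply; rewrite lerD2l mulrCA; apply: ler_wpM2l => //.
    by rewrite mulr_ge0 ?subr_ge0 // expR_le1 oppr_le0 !mulr_ge0 // ltW.
have phi0 u : 0 <= phi u by apply: Rintegral_ge0 => w _; exact: expR_ge0.
have := @discrete_gronwall R phi v v s (ltW v0) (ltW v0) s0 phi0.
have -> : phi 0 = 1.
  rewrite -(bm_int_cst P 1); apply: eq_Rintegral => w _.
  by rewrite mul0r expR0.
rewrite mul1r; apply=> t u t0 tu us.
have u0 : 0 <= u by exact: le_trans tu.
(* The tangent of [expR] at the upper end bounds the increment pointwise and replaces
   differentiation under the integral. *)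
apply: (@le_trans _ _ ((u - t) * \int[P]_w (D w * expR (u * D w)))); last first.
  by rewrite -mulrA ler_wpM2l ?subr_ge0 //; exact: mean.
rewrite -bm_intB // -bm_intZ //; apply: bm_int_le.
- exact: bmB.
- exact: bmZ.
by move=> w; have := exp_increment_le (t * D w) (u * D w); rewrite -mulrBl -mulrA.
Qed.

(** In this use [P - r] is [D]. The constraints force [D <= 1] and [D >= - 1/8], the latter from
    [q (1 - q) / 2 <= 1/8]; the affine bound is the one equal to 1 at [D = 1] and to 0 at
    [D = - 1/8]. *)
Lemma positive_part_mean_le (R : realFieldType) (q P r : R) :
  0 <= q <= 1 -> 0 <= P <= q -> 0 <= r <= q * (1 - q) / 2 ->
  P * (1 - r / q) <= 1 / 9 + 8 / 9 * (P - r).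
Proof.
move=> /andP[q0 q1] /andP[P0 Pq] /andP[r0 rq].
have [qz|qn] := eqVneq q 0.
  have Pz : P = 0 by lra.
  have rz : r = 0 by move: rq; rewrite qz; lra.
  by rewrite Pz rz mul0r; lra.
have qp : 0 < q by rewrite lt_def qn.
rewrite -(ler_pM2l qp).
have -> : q * (P * (1 - r / q)) = P * (q - r) by field.
(* The difference of both sides is affine in [r], so only an endpoint matters: [r = 0] in this case,
   [r = q (1 - q) / 2] in the other. *)
have [h|h] := lerP (8 / 9 * q) P.
  have : 0 <= r * (P - 8 / 9 * q) by rewrite mulr_ge0 // subr_ge0.
  have : 0 <= q * (1 - P) by rewrite mulr_ge0 //; lra.
  lra.
have hr : r * (8 / 9 * q - P) <= q * (1 - q) / 2 * (8 / 9 * q - P).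
  by rewrite ler_wpM2r //; lra.
(* Affine in [P] with slope [7 - 9 q]. The worst case is [P = 0], with value [2 (1 - 2 q)^2], or
   [P = 8 q / 9], with value [2 - 16 q / 9]. *)
have key : 0 <= 2 - 2 * P - (1 - q) * (8 * q - 9 * P).
  have sq := sqr_ge0 (1 - 2 * q).
  have [c|c] := lerP (9 * q) 7.
    have : 0 <= P * (7 - 9 * q) by rewrite mulr_ge0 //; lra.
    nra.
  have : 0 <= (8 / 9 * q - P) * (9 * q - 7) by rewrite mulr_ge0 //; lra.
  nra.
have := mulr_ge0 q0 key; lra.
Qed.

(** * Generalization gap *)

Section svr_generalization.
Context {R : realType} {X : ptopologicalType} {Y H : hilbertType R}.
Variables (ev : {linear H -> (X -> Y)}) (K : X -> X -> {linear Y -> Y}).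
Hypothesis Y_separable : separable Y.
Hypothesis H_separable : separable H.
Hypothesis HK : is_rkhs ev K.
Hypothesis K_measurable : forall y1 y2 : Y,
  measurable_fun [set: borel X * borel X]
    (fun x : borel X * borel X => inner (K x.1 x.2 y1) y2 : R).
Variables (eps lam kappa : R).
Hypothesis lam0 : 0 < lam.
Hypothesis kappa0 : 0 < kappa.
Hypothesis ev_le : forall f x, `|ev f x| <= kappa * `|f|.
Variable m : nat.
Hypothesis m0 : (0 < m)%N.
Variable fZ : ('I_m -> X * Y) -> H.
Hypothesis fZ_min : svr_learner ev eps lam fZ.

Local Notation T := (borel X * borel Y)%type.

Context d (Omega : measurableType d) (P : probability Omega R).
Variables (XY : Omega -> T) (Z : 'I_m -> Omega -> T).
Hypothesis mXY : measurable_fun [set: Omega] XY.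
Hypothesis mZ : forall k, measurable_fun [set: Omega] (Z k).
Hypothesis iid : forall B : 'I_m -> set T, (forall k, measurable (B k)) ->
  P [set w | forall k, B k (Z k w)] = (\prod_(k < m) P (XY @^-1` B k))%E.

Variables v b : R.
Hypothesis vE : v = m%:R^-1.
Hypothesis bE : b = kappa ^+ 2 / lam.
Let loss (p : X * Y) (f : H) := excess_loss ev eps p f.

Let v0 : 0 < v.
Proof. by rewrite vE invr_gt0 ltr0n. Qed.

Let vm : v * m%:R = 1.
Proof. by rewrite vE mulVf // pnatr_eq0 -lt0n. Qed.

Let b0 : 0 < b.
Proof. by rewrite bE divr_gt0 // exprn_gt0. Qed.

Lemma bm_excess_loss (f : H) : bounded_measurable (fun p : T => loss p f).
Proof.
split; last by exists (kappa * `|f|) => p; exact: excess_loss_norm.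
by apply: measurable_funB;
  exact: (measurable_svr_loss_fixed Y_separable H_separable HK K_measurable).
Qed.

Let bm_excess_loss_XY (f : H) : bounded_measurable (fun w => loss (XY w) f).
Proof. exact: (bm_comp (bm_excess_loss f) mXY). Qed.

Definition excess_risk (f : H) : R := \int[P]_w loss (XY w) f.

Lemma excess_risk_lipschitz f g : excess_risk f - excess_risk g <= kappa * `|f - g|.
Proof.
rewrite -(bm_intB P (bm_excess_loss_XY f) (bm_excess_loss_XY g)).
rewrite -[leRHS](bm_int_cst P); apply: bm_int_le.
- by apply: bmB; exact: bm_excess_loss_XY.
- exact: bm_cst.
- by move=> w; exact: excess_loss_lipschitz.
Qed.

Lemma excess_risk_norm f : `|excess_risk f| <= kappa * `|f|.
Proof.
apply: (bm_int_norm_le P (bm_excess_loss_XY f)) => w.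
exact: excess_loss_norm.
Qed.

(** Division by [b] makes the range 1 and the exchange bounds [2 v] and [3 v] independent of [kappa]
    and [lam]. *)
Definition excess_gap (z : 'I_m -> X * Y) : R :=
  (excess_risk (fZ z) - v * \sum_(k < m) loss (z k) (fZ z)) / b.

Let mean_loss_norm (z : 'I_m -> X * Y) f :
  `|v * \sum_(k < m) loss (z k) f| <= kappa * `|f|.
Proof.
rewrite normrM (gtr0_norm v0).
apply: (@le_trans _ _ (v * \sum_(k < m) kappa * `|f|)).
  rewrite ler_wpM2l ?(ltW v0) //; apply: (le_trans (ler_norm_sum _ _ _)).
  by apply: ler_sum => k _; exact: excess_loss_norm.
by rewrite sumr_const card_ord -[_ *+ m]mulr_natr mulrCA vm mulr1.
Qed.

Let kn (z : 'I_m -> X * Y) : kappa * `|fZ z| <= b / 2.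
Proof. by rewrite bE; exact: kappa_norm_le. Qed.

Lemma excess_gap_norm z : `|excess_gap z| <= 1.
Proof.
rewrite /excess_gap normrM normfV (gtr0_norm b0) (ler_pdivrMr _ _ b0) mul1r.
apply: (le_trans (ler_normB _ _)).
have := excess_risk_norm (fZ z); have := mean_loss_norm z (fZ z).
have := kn z; lra.
Qed.

Section measurable_family_of_samples.
Context d' (E : measurableType d') (z : 'I_m -> E -> T).
Hypothesis mz : forall k, measurable_fun [set: E] (z k).

Lemma measurable_excess_risk_learner :
  measurable_fun [set: E] (fun e => excess_risk (fZ (z^~ e))).
Proof.
apply: (measurable_lipschitz_learner Y_separable H_separable HK K_measurable
  lam0 kappa0 ev_le m0 fZ_min mz (Psi := fun _ f => excess_risk f)).
  by move=> h; exact: measurable_cst.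
by move=> _; exact: excess_risk_lipschitz.
Qed.

Lemma measurable_excess_loss_at (p : E -> T) : measurable_fun [set: E] p ->
  measurable_fun [set: E] (fun e => loss (p e) (fZ (z^~ e))).
Proof.
exact: (measurable_excess_loss_learner Y_separable H_separable HK K_measurable
  lam0 kappa0 ev_le m0 fZ_min mz).
Qed.

Lemma bm_excess_gap : bounded_measurable (fun e => excess_gap (z^~ e)).
Proof.
split; last by exists 1 => e; exact: excess_gap_norm.
apply: measurable_funM => //; apply: measurable_funB.
  exact: measurable_excess_risk_learner.
apply: measurable_funM => //; apply: measurable_sum => k.
exact: measurable_excess_loss_at.
Qed.

End measurable_family_of_samples.

Let U := famType T (option 'I_m).
Let zs (u : U) : 'I_m -> X * Y := fun k => u (Some k).
Let AU (j : 'I_m) (u : U) : R := (loss (u None) (fZ (zs u)) - loss (u (Some j)) (fZ (zs u))) / b.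
Let sg := sample_ghost XY Z.
Let sw (j : 'I_m) (w : Omega * Omega) : U := fun o => sg w (ghost_swap j o).

Let bm_gapU : bounded_measurable (fun u : U => excess_gap (zs u)).
Proof. by apply: (bm_excess_gap (z := fun k (u : U) => u (Some k))) => k; exact: measurable_family_coord. Qed.

Let AU_le1 j u : `|AU j u| <= 1.
Proof.
rewrite /AU normrM normfV (gtr0_norm b0) (ler_pdivrMr _ _ b0) mul1r.
apply: (le_trans (ler_normB _ _)).
have := excess_loss_norm eps ev_le (u None) (fZ (zs u)).
have := excess_loss_norm eps ev_le (u (Some j)) (fZ (zs u)).
by have := kn (zs u); rewrite /loss; lra.
Qed.

Let bm_AU j : bounded_measurable (AU j).
Proof.
split; last by exists 1; exact: AU_le1.
apply: measurable_funM => //; apply: measurable_funB.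
  apply: (measurable_excess_loss_at (z := fun k (u : U) => u (Some k))).
    by move=> k; exact: measurable_family_coord.
  exact: measurable_family_coord.
apply: (measurable_excess_loss_at (z := fun k (u : U) => u (Some k))).
  by move=> k; exact: measurable_family_coord.
exact: measurable_family_coord.
Qed.

Let msg : measurable_fun [set: Omega * Omega] (sg : _ -> U).
Proof. by apply: measurable_family; exact: measurable_sample_ghost. Qed.

Let msw j : measurable_fun [set: Omega * Omega] (sw j : _ -> U).
Proof. by apply: measurable_family => o; exact: measurable_sample_ghost. Qed.

Let sw_zs j w : zs (sw j w) = fun k => if k == j then XY w.2 else zs (sg w) k.
Proof.
by apply/funext => k; rewrite /zs /sw /ghost_swap /=; case: (eqVneq k j) => [->|kj];
  rewrite ?eqxx //= ; case: eqP => // -[] /eqP; rewrite (negPf kj).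
Qed.

Let AU_sw j w : AU j (sw j w) =
  (loss (Z j w.1) (fZ (zs (sw j w))) - loss (XY w.2) (fZ (zs (sw j w)))) / b.
Proof. by rewrite /AU {1 3}/sw /ghost_swap /= eqxx. Qed.

Let exch j (Phi : U -> R) : bounded_measurable Phi ->
  \int[(P \x P)%E]_w Phi (sg w) = \int[(P \x P)%E]_w Phi (sw j w).
Proof. exact: (sample_ghost_exchangeable mXY mZ iid (ghost_swapK j)). Qed.

Let gap_mean w : excess_gap (fun k => Z k w) =
  \int[P]_w' (v * \sum_(j < m) AU j (sg (w, w'))).
Proof.
set f := fZ (fun k => Z k w).
transitivity (\int[P]_w' (b^-1 * (loss (XY w') f - v * \sum_(k < m) loss (Z k w) f))).
  have bc : bounded_measurable (fun _ : Omega => v * \sum_(k < m) loss (Z k w) f).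
    exact: bm_cst.
  rewrite (bm_intZ P b^-1 (bmB (bm_excess_loss_XY f) bc)).
  by rewrite (bm_intB P (bm_excess_loss_XY f) bc) bm_int_cst mulrC.
apply: eq_Rintegral => w' _; rewrite /AU /= -/f -mulr_suml.
have -> : \sum_(k < m) (loss (XY w') f - loss (Z k w) f) =
    loss (XY w') f * m%:R - \sum_(k < m) loss (Z k w) f.
  by rewrite big_split /= sumr_const card_ord mulr_natr sumrN.
rewrite [RHS]mulrA [RHS]mulrC; congr (_ * _).
by rewrite mulrBr mulrCA vm mulr1.
Qed.

(* Shifted and scaled, the losses p of the ghost point and r_j of the sample lie
   in [0, q], so that (p - r_j)^+ <= p (1 - r_j / q); strong convexity bounds
   the mean of the r_j by q (1 - q) / 2. *)
Let positive_part_le w :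
  \int[P]_w' (v * \sum_(j < m) Num.max (AU j (sg (w, w'))) 0) <=
  1 / 9 + 8 / 9 * excess_gap (fun k => Z k w).
Proof.
set f := fZ (fun k => Z k w).
pose q := 2 * (kappa * `|f|) / b.
have knf : kappa * `|f| <= b / 2 by exact: kn.
have kf0 : 0 <= kappa * `|f| by rewrite mulr_ge0 // ltW.
have q0 : 0 <= q by rewrite divr_ge0 ?(ltW b0) // mulr_ge0.
have q1 : q <= 1 by rewrite (ler_pdivrMr _ _ b0) mul1r; lra.
pose sc p := (loss p f + kappa * `|f|) / b.
have sc01 p : 0 <= sc p <= q.
  have := excess_loss_norm eps ev_le p f; rewrite ler_norml => /andP[l1 l2].
  apply/andP; split; first by rewrite divr_ge0 ?(ltW b0) //; rewrite /loss; lra.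
  by rewrite /sc /q ler_pM2r ?invr_gt0 ?b0 //; rewrite /loss; lra.
have bk : bounded_measurable (fun _ : Omega => kappa * `|f|) by exact: bm_cst.
have bsc : bounded_measurable (fun w' => sc (XY w')).
  apply: bmM; last exact: bm_cst.
  by apply: bmD bk; exact: bm_excess_loss_XY.
pose r := v * \sum_(k < m) sc (Z k w).
have rE : r = (v * \sum_(k < m) loss (Z k w) f + kappa * `|f|) / b.
  rewrite /r /sc -mulr_suml big_split /= sumr_const card_ord -[_ *+ m]mulr_natr.
  by rewrite mulrA mulrDr (mulrCA v) vm mulr1.
pose Q := \int[P]_w' sc (XY w').
have QE : Q = (excess_risk f + kappa * `|f|) / b.
  transitivity (\int[P]_w' (b^-1 * (loss (XY w') f + kappa * `|f|))).
    by apply: eq_Rintegral => w' _; rewrite mulrC.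
  rewrite (bm_intZ P b^-1 (bmD (bm_excess_loss_XY f) bk)).
  by rewrite (bm_intD P (bm_excess_loss_XY f) bk) bm_int_cst mulrC.
have Q01 : 0 <= Q <= q.
  apply/andP; split; [rewrite -[leLHS](bm_int_cst P)|rewrite -[leRHS](bm_int_cst P)].
    apply: bm_int_le; [exact: bm_cst|exact: bsc|move=> w'].
    by have /andP[] := sc01 (XY w').
  apply: bm_int_le; [exact: bsc|exact: bm_cst|move=> w'].
  by have /andP[] := sc01 (XY w').
have r01 : 0 <= r <= q * (1 - q) / 2.
  apply/andP; split.
    rewrite /r; apply: mulr_ge0; first exact: (ltW v0).
    by apply: sumr_ge0 => k _; have /andP[] := sc01 (Z k w).
  have ex : v * \sum_(k < m) loss (Z k w) f <= - (2 * lam * `|f| ^+ 2).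
    by rewrite vE; exact: (svr_learner_excess_le lam0 m0 fZ_min).
  rewrite rE (ler_pdivrMr _ _ b0).
  (* By the choice of [q] and [b], [q b / 2] is the shift [kappa |f|] and [q^2 b / 2] is the gain
     [2 lam |f|^2] over the zero function. *)
  have -> : q * (1 - q) / 2 * b = kappa * `|f| - 2 * lam * `|f| ^+ 2.
    rewrite /q bE; field.
    by rewrite !gt_eqF.
  lra.
have gapE : excess_gap (fun k => Z k w) = Q - r.
  by rewrite QE rE /excess_gap -/f -mulrBl; congr (_ * _); ring.
have q01 : 0 <= q <= 1 by rewrite q0.
rewrite gapE; apply: le_trans (positive_part_mean_le q01 Q01 r01).
rewrite mulrC -(bm_intZ P (1 - r / q) bsc); apply: bm_int_le.
- apply: bmZ; apply: bm_sum => j; apply: bm_max0.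
  apply: (bm_comp (f := fun w => AU j (sg w)) (h := fun w' => (w, w'))).
    exact: (bm_comp (bm_AU j) msg).
  exact: pair1_measurable.
- exact: bmZ.
move=> w'.
apply: (@le_trans _ _ (v * \sum_(j < m) (1 - sc (Z j w) / q) * sc (XY w'))).
  rewrite ler_wpM2l ?(ltW v0) //; apply: ler_sum => j _.
  have -> : AU j (sg (w, w')) = sc (XY w') - sc (Z j w).
    by rewrite /AU /sc /= -/f -mulrBl; congr (_ * _); ring.
  have /andP[a0 aq] := sc01 (XY w'); have /andP[c0 cq] := sc01 (Z j w).
  have [qz|qn] := eqVneq q 0.
    have -> : sc (XY w') = 0 by lra.
    have -> : sc (Z j w) = 0 by lra.
    by rewrite subrr maxxx mulr0.
  have qp : 0 < q by rewrite lt_def qn.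
  have c1 : sc (Z j w) / q <= 1 by rewrite ler_pdivrMr // mul1r.
  rewrite ge_max; apply/andP; split; last by rewrite mulr_ge0 // subr_ge0.
  rewrite mulrBl mul1r lerD2l lerN2 mulrAC ler_pdivrMr //.
  by rewrite ler_wpM2l.
rewrite -mulr_suml mulrA; apply: ler_wpM2r; first by have /andP[] := sc01 (XY w').
rewrite sumrB sumr_const card_ord -mulr_suml mulrBr vm lerB //.
by rewrite /r mulrA.
Qed.

Let exchange_AU_le j w : AU j (sg w) + AU j (sw j w) <= 2 * v.
Proof.
have := exchange_sum_le lam0 kappa0 ev_le m0 fZ_min (zs (sg w)) j (XY w.2).
rewrite -sw_zs -vE -bE => H1.
rewrite AU_sw /AU /= -mulrDl (ler_pdivrMr _ _ b0).
by move: H1; rewrite /loss /zs /=; lra.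
Qed.

(** One [v] comes from the risk, which only sees the change of [f_Z]; two come from the empirical
    mean, where a sample point changes as well. *)
Let exchange_gap_le j w : `|excess_gap (zs (sg w)) - excess_gap (zs (sw j w))| <= 3 * v.
Proof.
have := empirical_excess_stability lam0 kappa0 ev_le m0 fZ_min (zs (sg w)) j (XY w.2).
have := kappa_stability lam0 kappa0 ev_le m0 fZ_min (zs (sg w)) j (XY w.2).
rewrite -sw_zs -vE -bE => H1 H2.
rewrite /excess_gap -mulrBl normrM normfV (gtr0_norm b0) (ler_pdivrMr _ _ b0).
have l1 := excess_risk_lipschitz (fZ (zs (sg w))) (fZ (zs (sw j w))).
have l2 := excess_risk_lipschitz (fZ (zs (sw j w))) (fZ (zs (sg w))).
rewrite (distrC (fZ (zs (sw j w)))) in l2.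
have E : \sum_(k < m) loss (zs (sw j w) k) (fZ (zs (sw j w))) =
    \sum_(k < m) excess_loss ev eps (if k == j then XY w.2 else zs (sg w) k)
      (fZ (zs (sw j w))).
  by apply: eq_bigr => k _; rewrite {1}sw_zs.
rewrite E; move: H2; rewrite !ler_norml => /andP[h1 h2]; apply/andP.
by rewrite /loss; split; lra.
Qed.

Lemma excess_gap_mgf_le (s : R) : 0 <= s ->
  \int[P]_w expR (s * excess_gap (fun k => Z k w)) <= expR (v * s + v * s ^+ 2 / 2).
Proof.
move=> s0.
have AU1 j u : AU j u <= 1 by exact: le_trans (ler_norm _) (AU_le1 j u).
apply: (@exchangeable_mgf_le _ _ _ P m (fun w => excess_gap (fun k => Z k w))
  (fun j w => AU j (sg w)) (fun j w => AU j (sw j w))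
  (fun j w => excess_gap (zs (sw j w))) s v vE m0).
- exact: bm_excess_gap.
- by move=> j; exact: (bm_comp (bm_AU j) msg).
- by move=> j; exact: (bm_comp (bm_AU j) (msw j)).
- by move=> j; exact: (bm_comp bm_gapU (msw j)).
- move=> j u; apply: (exch j (Phi := fun x => AU j x * expR (u * excess_gap (zs x)))).
  by apply: bmM; [exact: bm_AU|apply: bm_exp; exact: (bmZ u bm_gapU)].
- move=> j u; apply: (exch j (Phi := fun x => Num.max (AU j x) 0 * expR (u * excess_gap (zs x)))).
  by apply: bmM; [apply: bm_max0; exact: bm_AU|apply: bm_exp; exact: (bmZ u bm_gapU)].
- move=> j u; apply: (exch j (Phi := fun x => expR (u * excess_gap (zs x)))).
  by apply: bm_exp; exact: (bmZ u bm_gapU).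
- exact: gap_mean.
- exact: positive_part_le.
- by move=> w; exact: le_trans (ler_norm _) (excess_gap_norm _).
- by move=> j w; exact: AU1.
- by move=> j w; exact: AU1.
- exact: exchange_AU_le.
- exact: exchange_gap_le.
- exact: s0.
Qed.

End svr_generalization.

(** [U0] and [U1] depend on the same sample, so their moment generating functions cannot be
    multiplied. Weights [C / k] and [2 b / k], proportional to the scales, let convexity of [expR]
    combine them, and the scales add up to [k = 2 b + C]. *)
Lemma two_part_tail d (Omega : measurableType d) (R : realType)
    (P : probability Omega R) (U0 U1 : Omega -> R) (v b C L : R) :
  0 < v -> 0 < b -> 0 < C -> 0 <= L ->
  bounded_measurable U0 -> bounded_measurable U1 ->
  (forall t, 0 <= t -> \int[P]_w expR (t * U0 w) <= expR (v * (t ^+ 2 * C ^+ 2 / 8))) ->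
  (forall t, 0 <= t -> \int[P]_w expR (t * U1 w) <= expR (v * t + v * t ^+ 2 / 2)) ->
  (P [set w | (v * b + Num.sqrt v * (2 * b + C) * Num.sqrt (L / 2) < U0 w + b * U1 w)%R]
    <= (expR (- L))%:E)%E.
Proof.
move=> v0 b0 C0 L0 bU0 bU1 mgf0 mgf1.
have [k kE] : exists k, k = 2 * b + C by exists (2 * b + C).
rewrite -kE; set tau := _ * k * _; set bad := [set w | _].
have k0 : 0 < k by rewrite kE; lra.
have tau0 : 0 <= tau by rewrite !mulr_ge0 ?sqrtr_ge0 // ltW.
have tau2 : tau ^+ 2 = v * k ^+ 2 * (L / 2).
  by rewrite /tau !exprMn !sqr_sqrtr ?(ltW v0) // divr_ge0.
(* Maximizes [s tau - v s^2 k^2 / 8]; the maximum is [L]. *)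
pose s := 4 * tau / (v * k ^+ 2).
have vk0 : 0 < v * k ^+ 2 by rewrite mulr_gt0 // exprn_gt0.
have s0 : 0 <= s by rewrite divr_ge0 ?(ltW vk0) // mulr_ge0.
pose th := C / k.
have th0 : 0 <= th by rewrite divr_ge0 ?(ltW C0) // ltW.
have th1 : th <= 1 by rewrite ler_pdivrMr // mul1r kE; lra.
pose c1 := v * (s * k / C) ^+ 2 * C ^+ 2 / 8.
pose c2 := v * (s * k / 2) + v * (s * k / 2) ^+ 2 / 2.
(* Exponentials of [s U0 / th] and [s b U1 / (1 - th)], normalized to mean at most 1. With these
   weights both quadratic exponents equal [v s^2 k^2 / 8], and the linear one in [c2] yields the
   bias [v b]. The indicator of [bad] is then at most [exp (- L)] times the weighted mean of [V0]
   and [V1]. *)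
pose V0 w := expR (- c1) * expR (s * k / C * U0 w).
pose V1 w := expR (- c2) * expR (s * k / 2 * U1 w).
have bV0 : bounded_measurable V0 by apply: bmZ; apply: bm_exp; exact: bmZ.
have bV1 : bounded_measurable V1 by apply: bmZ; apply: bm_exp; exact: bmZ.
have iV0 : \int[P]_w V0 w <= 1.
  rewrite bm_intZ; last by apply: bm_exp; exact: bmZ.
  have t0 : 0 <= s * k / C by rewrite divr_ge0 ?(ltW C0) // mulr_ge0 // ltW.
  have := ler_wpM2l (expR_ge0 (- c1)) (mgf0 _ t0).
  rewrite -expRD (_ : - c1 + _ = 0) ?expR0 //; by rewrite /c1; ring.
have iV1 : \int[P]_w V1 w <= 1.
  rewrite bm_intZ; last by apply: bm_exp; exact: bmZ.
  have t0 : 0 <= s * k / 2 by rewrite divr_ge0 // mulr_ge0 // ltW.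
  have := ler_wpM2l (expR_ge0 (- c2)) (mgf1 _ t0).
  by rewrite -expRD addNr expR0.
have mbad : measurable bad.
  rewrite (_ : bad = (fun w => U0 w + b * U1 w) @^-1` `]v * b + tau, +oo[).
    rewrite -[X in measurable X]setTI.
    have [mf _] : bounded_measurable (fun w => U0 w + b * U1 w).
      by apply: bmD => //; exact: bmZ.
    exact: mf.
  by apply/seteqP; split => w /=; rewrite in_itv /= andbT.
have bind : bounded_measurable (\1_bad : Omega -> R).
  split; first exact: measurable_indic.
  by exists 1 => w; rewrite indicE; case: (_ \in _); rewrite ?normr1 ?normr0.
have PE : P bad = (\int[P]_w \1_bad w)%:E.
  by rewrite -bm_integral_fin // integral_indic // setIT.
rewrite PE lee_fin.
have -> : expR (- L) = \int[P]_w (expR (- L)) by rewrite bm_int_cst.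
apply: (@le_trans _ _ (\int[P]_w (expR (- L) * (th * V0 w + (1 - th) * V1 w)))).
  apply: bm_int_le => // [|w].
    by apply: bmZ; apply: bmD; exact: bmZ.
  rewrite indicE; case: (boolP (w \in bad)) => [|_]; last first.
    apply: mulr_ge0; first exact: expR_ge0.
    apply: addr_ge0; apply: mulr_ge0 => //; rewrite ?subr_ge0 //;
      apply: mulr_ge0; exact: expR_ge0.
  rewrite inE /bad /= => wb.
  set x := s * k / C * U0 w - c1; set y := s * k / 2 * U1 w - c2.
  have -> : V0 w = expR x by rewrite /V0 -expRD addrC.
  have -> : V1 w = expR y by rewrite /V1 -expRD addrC.
  have e1 := exp_increment_le x L; have e2 := exp_increment_le y L.
  have kn : k != 0 by rewrite gt_eqF.
  have Cn : C != 0 by rewrite gt_eqF.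
  have lin : L <= th * x + (1 - th) * y.
    have -> : th * x + (1 - th) * y =
        s * (U0 w + b * U1 w - v * b) - v * s ^+ 2 * k ^+ 2 / 8.
      have -> : b = (k - C) / 2 by rewrite kE; field.
      by rewrite /th /x /y /c1 /c2; field; rewrite ?kn ?Cn.
    have sL : s * tau - v * s ^+ 2 * k ^+ 2 / 8 = L.
      have -> : s * tau - v * s ^+ 2 * k ^+ 2 / 8 = 2 * tau ^+ 2 / (v * k ^+ 2).
        by rewrite /s; field; rewrite kn gt_eqF.
      by rewrite tau2; field; rewrite kn gt_eqF.
    rewrite -{1}sL lerD2r ler_wpM2l //; lra.
  have th1' : 0 <= 1 - th by rewrite subr_ge0.
  have := ler_wpM2l th0 e1; have := ler_wpM2l th1' e2.
  have EL := expR_gt0 L.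
  have : 0 <= (th * x + (1 - th) * y - L) * expR L.
    by rewrite mulr_ge0 ?subr_ge0 // ltW.
  move=> h0 h2 h1; rewrite -(ler_pM2l EL) mulrA -expRD subrr expR0 mul1r mulr1.
  lra.
rewrite bm_intZ; last by apply: bmD; exact: bmZ.
rewrite bm_int_cst ler_piMr ?expR_ge0 //.
rewrite bm_intD; [|exact: bmZ|exact: bmZ].
rewrite (bm_intZ P th bV0) (bm_intZ P (1 - th) bV1).
have := ler_wpM2l th0 iV0.
have := @ler_wpM2l _ (1 - th) ltac:(by rewrite subr_ge0) _ _ iV1; lra.
Qed.

(** Choosing the whole space at the index [None] restricts the joint independence to the sample. *)
Lemma iid_of_independent d d' (Omega : measurableType d) (T : measurableType d')
    (R : realType) (P : probability Omega R) (m : nat) (XY : {RV P >-> T})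
    (Z : 'I_m -> {RV P >-> T}) :
  (forall k, same_distribution (Z k) XY) ->
  mutually_independent (fun i : option 'I_m => if i is Some k then Z k else XY) ->
  forall B : 'I_m -> set T, (forall k, measurable (B k)) ->
  P [set w | forall k, B k (Z k w)] = (\prod_(k < m) P (XY @^-1` B k))%E.
Proof.
move=> distr indep B mB.
pose B' (o : option 'I_m) := if o is Some k then B k else setT.
have mB' o : measurable (B' o) by case: o => [k|] /=; [exact: mB|exact: measurableT].
have := indep [set: option 'I_m]%SET B' mB'.
rewrite (_ : \bigcap_(i in _) _ = [set w | forall k, B k (Z k w)]); last first.
  apply/seteqP; split => w /=; first by move=> h k; have := h (Some k); rewrite /= finset.in_setT; apply.
  by move=> h [k|] _ //=.
move=> ->; rewrite (bigD1 None) ?finset.in_setT //=.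
rewrite [X in (P X * _)%E](_ : _ = setT) // probability_setT mul1e.
rewrite (reindex_omap Some id) /=; last by move=> [k|] //; rewrite andbF.
apply: eq_big => [k|k _]; first by rewrite finset.in_setT eqxx.
exact: distr.
Qed.

Theorem mainTheorem5 (R : realType) (X : ptopologicalType)
    (Y H : hilbertType R) (ev : {linear H -> (X -> Y)})
    (K : X -> X -> {linear Y -> Y})
    (X_polish : polish R X) (Y_separable : separable Y)
    (H_separable : separable H) (HK : is_rkhs ev K)
    (K_measurable : forall y1 y2 : Y,
      measurable_fun [set: borel X * borel X]
        (fun x : borel X * borel X => inner (K x.1 x.2 y1) y2 : R))
    (lambda eps kappa Cy : R) (lambda_gt0 : 0 < lambda) (eps_ge0 : 0 <= eps)
    (kappa_gt0 : 0 < kappa)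
    (K_bounded : forall x : X, opnorm (K x x) <= kappa ^+ 2)
    (d : measure_display) (Omega : measurableType d) (P : probability Omega R)
    (XY : {RV P >-> (borel X * borel Y)%type})
    (Cy_gt0 : 0 < Cy) (Y_bounded : {ae P, forall w, `|(XY w).2 : Y| < Cy})
    (m : nat) (m_gt0 : (0 < m)%N)
    (Z : 'I_m -> {RV P >-> (borel X * borel Y)%type})
    (Z_distr : forall k, same_distribution (Z k) XY)
    (Z_indep : mutually_independent
      (fun i : option 'I_m => if i is Some k then Z k else XY))
    (fZ : ('I_m -> X * Y) -> H) (fZ_min : svr_learner ev eps lambda fZ)
    (delta : R) (delta_gt0 : 0 < delta) (delta_le1 : delta <= 1) :
  let good : set Omega := [set w |
    let z : 'I_m -> X * Y := fun k => Z k w in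
    ('E_P[(fun w' => svr_loss ev eps (XY w').2 (fZ z) (XY w').1)] <=
      (empirical_risk ev eps (fZ z) z
       + m%:R^-1 * (kappa ^+ 2 / lambda)
       + Num.sqrt (m%:R^-1)
         * (2 * kappa ^+ 2 / lambda + Cy * (1 + kappa / Num.sqrt lambda))
         * Num.sqrt (ln (1 / delta) / 2))%:E)%E] in
  measurable good /\ ((1 - delta)%:E <= P good)%E.

Proof.
move=> good.
have ev_le f x : `|ev f x| <= kappa * `|f|.
  by apply: (feature_norm_le HK _ K_bounded); exact: ltW.
have mXY : measurable_fun [set: Omega] (XY : Omega -> borel X * borel Y).
  exact: measurable_funPT.
have mZ k : measurable_fun [set: Omega] (Z k : Omega -> borel X * borel Y).
  exact: measurable_funPT.
have iid := iid_of_independent Z_distr Z_indep.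
have mloss h := measurable_svr_loss_fixed Y_separable H_separable HK K_measurable eps h.
pose v : R := m%:R^-1; pose b : R := kappa ^+ 2 / lambda.
have v0 : 0 < v by rewrite invr_gt0 ltr0n.
have b0 : 0 < b by rewrite divr_gt0 // exprn_gt0.
pose zs w : 'I_m -> X * Y := fun k => Z k w.
(* Truncation at [Cy] makes the loss at 0 bounded everywhere. For the pair [XY] it changes nothing
   almost surely, and on the sample it can only lower the empirical risk, which is the favourable
   direction. *)
pose c0 (p : borel X * borel Y) : R := Num.min (svr_loss ev eps p.2 0 p.1) Cy.
have mc0 : measurable_fun [set: borel X * borel Y] c0.
  by apply: measurable_minr => //; exact: mloss.
have c001 p : 0 <= c0 p <= Cy.
  by rewrite le_min ge_min lexx orbT andbT (ltW Cy_gt0) andbT le_max lexx orbT.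
have bc0 : bounded_measurable c0.
  by split => //; exists Cy => p; have /andP[? ?] := c001 p; rewrite ger0_norm.
have bc0X : bounded_measurable (fun w => c0 (XY w)) by exact: (bm_comp bc0 mXY).
pose mu := \int[P]_w c0 (XY w).
pose ER f := excess_risk ev eps P XY f.
have riskE f : ('E_P[(fun w' => svr_loss ev eps (XY w').2 f (XY w').1)] =
    (mu + ER f)%:E)%E.
  have bl : bounded_measurable (fun w => excess_loss ev eps (XY w) f).
    exact: (bm_comp (bm_excess_loss Y_separable H_separable HK K_measurable eps
      ev_le f) mXY).
  rewrite /mu /ER /excess_risk -bm_intD // -bm_integral_fin; last exact: bmD.
  rewrite unlock; apply: ae_eq_integral => //.
  - by apply/measurable_EFinP; exact: (measurableT_comp (mloss f) mXY).
  - by apply/measurable_EFinP; apply: (bmD bc0X bl).1.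
  - move: Y_bounded; apply: filterS => w yw _ /=; congr EFin.
    have ev0 : ev 0 (XY w).1 = 0 by rewrite linear0.
    have l0 : svr_loss ev eps (XY w).2 0 (XY w).1 <= Cy.
      rewrite /svr_loss ev0 subr0 ge_max (ltW Cy_gt0) andbT.
      by apply: le_trans (ltW yw); rewrite gerBl.
    by rewrite /c0 (min_l l0) /excess_loss addrC subrK.
pose cst : R := v * (kappa ^+ 2 / lambda) + Num.sqrt v
  * (2 * kappa ^+ 2 / lambda + Cy * (1 + kappa / Num.sqrt lambda))
  * Num.sqrt (ln (1 / delta) / 2).
pose gapf w := mu + ER (fZ (zs w)) - empirical_risk ev eps (fZ (zs w)) (zs w).
have goodE : good = [set w | gapf w <= cst].
  apply/seteqP; split => w; rewrite /good /= -/(zs w) riskE lee_fin /gapf /cst.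
    by rewrite -addrA -[X in _ <= _ + X -> _]/cst lerBlDl.
  by rewrite -[X in _ -> _ <= X]addrA lerBlDl.
have empE w : empirical_risk ev eps (fZ (zs w)) (zs w) =
    v * \sum_(k < m) excess_loss ev eps (Z k w) (fZ (zs w)) +
    empirical_risk ev eps 0 (zs w).
  by rewrite (empirical_excessE ev eps (zs w) (fZ (zs w))) subrK.
have mgap : measurable_fun [set: Omega] gapf.
  apply: measurable_funB.
    apply: measurable_funD => //.
    exact: (measurable_excess_risk_learner Y_separable H_separable HK K_measurable
      lambda_gt0 kappa_gt0 ev_le m_gt0 fZ_min P mXY mZ).
  under eq_fun do rewrite empE; apply: measurable_funD; last first.
    exact: (measurable_empirical_risk_fixed Y_separable H_separable HK K_measurable eps mZ).
  apply: measurable_funM => //; apply: measurable_sum => k.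
  exact: (measurable_excess_loss_at Y_separable H_separable HK K_measurable
    lambda_gt0 kappa_gt0 ev_le m_gt0 fZ_min mZ (mZ k)).
have mgood : measurable good.
  rewrite goodE (_ : [set w | _] = gapf @^-1` `]-oo, cst]).
    by rewrite -[X in measurable X]setTI; exact: mgap.
  by apply/seteqP; split => w /=; rewrite in_itv.
split; first exact: mgood.
pose L := ln (1 / delta).
have L0 : 0 <= L by rewrite ln_ge0 // div1r invf_ge1.
pose U0 w := mu - v * \sum_(k < m) c0 (Z k w).
pose U1 w := excess_gap ev eps fZ P XY v b (zs w).
have bU0 : bounded_measurable U0.
  apply: bmB; first exact: bm_cst.
  by apply: bmZ; apply: bm_sum => k; exact: (bm_comp bc0 (mZ k)).
have bU1 : bounded_measurable U1.
  exact: (bm_excess_gap Y_separable H_separable HK K_measurable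
    lambda_gt0 kappa_gt0 ev_le m_gt0 fZ_min P mXY (erefl v) (erefl b) mZ).
have := @two_part_tail _ _ _ P U0 U1 v b Cy L v0 b0 Cy_gt0 L0 bU0 bU1.
set bad := [set w | _] => tail.
have {}tail : (P bad <= delta%:E)%E.
  have -> : delta = expR (- L).
    by rewrite expRN lnK ?posrE ?divr_gt0 // div1r invrK.
  apply: tail => t t0.
    exact: (hoeffding_sample_mean mXY mZ iid m_gt0 mc0 c001 Cy_gt0 t0).
  exact: (excess_gap_mgf_le Y_separable H_separable HK K_measurable
    lambda_gt0 kappa_gt0 ev_le m_gt0 fZ_min mXY mZ iid (erefl v) (erefl b) t0).
have mbad : measurable bad.
  rewrite (_ : bad = (fun w => U0 w + b * U1 w) @^-1`
      `]v * b + Num.sqrt v * (2 * b + Cy) * Num.sqrt (L / 2), +oo[).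
    by rewrite -[X in measurable X]setTI; apply: (bmD bU0 (bmZ b bU1)).1.
  by apply/seteqP; split => w /=; rewrite in_itv /= andbT.
have sub : ~` bad `<=` good.
  rewrite goodE => w /=; rewrite /bad /= => /negP; rewrite -leNgt => H1.
  have bU : b * U1 w = ER (fZ (zs w)) -
      v * \sum_(k < m) excess_loss ev eps (Z k w) (fZ (zs w)).
    by rewrite /U1 /excess_gap mulrC divfK // gt_eqF.
  have emp0 : v * \sum_(k < m) c0 (Z k w) <= empirical_risk ev eps 0 (zs w).
    rewrite /empirical_risk ler_wpM2l ?(ltW v0) //; apply: ler_sum => k _.
    by rewrite /c0 ge_min lexx.
  (* The tail bound has been obtained with [2 b + Cy]; the stated constant exceeds it by
     [Cy kappa / sqrt lambda]. *)
  have k0 : 2 * b + Cy <=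
      2 * kappa ^+ 2 / lambda + Cy * (1 + kappa / Num.sqrt lambda).
    rewrite mulrDr mulr1 /b mulrA addrA lerDl.
    by rewrite mulr_ge0 ?(ltW Cy_gt0) // divr_ge0 ?sqrtr_ge0 // ltW.
  have k1 : Num.sqrt v * (2 * b + Cy) * Num.sqrt (L / 2) <= Num.sqrt v
      * (2 * kappa ^+ 2 / lambda + Cy * (1 + kappa / Num.sqrt lambda))
      * Num.sqrt (L / 2).
    by rewrite ler_wpM2r ?sqrtr_ge0 // ler_wpM2l ?sqrtr_ge0.
  move: H1; rewrite bU /gapf empE /cst -/L -/b /U0.
  lra.
apply: (@le_trans _ _ (P (~` bad))); last first.
  by apply: le_measure; rewrite ?inE //; exact: measurableC.
rewrite probability_setC // EFinB leeB //.
Qed.
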